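(* Let $\mu_t^y(\cdot)=\Pr\{\sigma^{f,y}(t)\in\cdot\}$, $t\ge0$, be the transition probabilities on $[0,\infty)$ of the subordinator $\sigma^{f,y}$ with Laplace exponent $f(\cdot,y)$, and suppose $\mu_t^y\in\mathrm{GGC}$ for all $y\in E$. Then for the corresponding distributed order subordinator $\sigma^{f,p}$ the law $\mu_t^p(\cdot)=\Pr\{\sigma^{f,p}(t)\in\cdot\}$ satisfies $\mu_t^p\in\mathrm{GGC}$.
   Context: Setting. $E$ is a Polish space, $W\subseteq E$ is Borel, $p$ is a probability measure on $W$, $Y$ is a random variable with law $p$, and $\mathbb{E}g(Y)=\int_W g(y)\,p(dy)$. For each $y\in E$, $$f(\lambda,y)=a(y)+b(y)\lambda+\int_0^\infty(1-e^{-\lambda s})\,\nu(ds,y),\qquad \lambda>0,$$ is a Bernstein function, where $a(y),b(y)\ge 0$ and $\nu(ds,y)$ is a non-negative $\sigma$-finite measure on $(0,\infty)$ (depending measurably on $y$) with $V(y):=\int_0^\infty (s\wedge 1)\,\nu(ds,y)<\infty$. Standing assumptions. A1) the functions $a,b$ are Borel measurable and either bounded, or such that $\int_W a(y)p(dy)<\infty$ and $\int_W b(y)p(dy)<\infty$. A2) either $V$ is bounded, or $\int_W V(y)p(dy)<\infty$. Under these, $\mathbb{E}f(\lambda,Y)=\mathbb{E}a(Y)+\mathbb{E}b(Y)\lambda+\int_0^\infty(1-e^{-\lambda s})\int_W\nu(ds,y)p(dy)$ is a Bernstein function. Subordinators. $\sigma^{f,y}$ is the (possibly killed, i.e. sent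 to $\infty$) subordinator with $\mathbb{E}e^{-\lambda\sigma^{f,y}(t)}=e^{-tf(\lambda,y)}$. The distributed order subordinator is $\sigma^{f,p}(t)=t\int_W b(y)p(dy)+\sum_{0\le s\le t}\mathbf{e}(s)$, where $\mathbf{e}$ is a Poisson point process with characteristic measure $\int_W(\nu(dx,y)+a(y)\delta_\infty(dx))p(dy)$; equivalently it is the subordinator with $\mathbb{E}e^{-\lambda\sigma^{f,p}(t)}=e^{-t\,\mathbb{E}f(\lambda,Y)}$. Generalized gamma convolutions. A Bernstein function $g$ is a Thorin–Bernstein function if its derivative is a Stieltjes function; equivalently $g(\lambda)=\alpha+\beta\lambda+\int_0^\infty(1-e^{-\lambda t})\,\tau(t)\,dt$ with $\alpha,\beta\ge0$, $\int_0^\infty(t\wedge1)\tau(t)dt<\infty$ and $t\mapsto t\,\tau(t)$ completely monotone. A measure $\mu$ on $[0,\infty)$ belongs to $\mathrm{GGC}$ if its Laplace transform is $e^{-g(\lambda)}$ with $g$ a Thorin–Bernstein function. *)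

(* Defs.v *)
From HB Require Import structures.
From mathcomp Require Import all_boot all_order all_algebra.
From mathcomp Require Import all_classical all_reals all_analysis.
From mathcomp Require Import measurable_realfun.

Set Implicit Arguments.
Unset Strict Implicit.
Unset Printing Implicit Defensive.
Import Order.TTheory GRing.Theory Num.Theory.
Import numFieldNormedType.Exports.
Local Open Scope classical_set_scope.
Local Open Scope ring_scope.

Definition polish_space (R : realType) (E : topologicalType) : Prop :=
  (exists2 D : set E, countable D & dense D) /\
  exists d : E -> E -> R,
    [/\ forall x y, 0 <= d x y /\ (d x y = 0 <-> x = y),
        forall x y, d x y = d y x,
        forall x y z, d x z <= d x y + d y z,
        forall (x : E) (A : set E),
          nbhs x A <-> exists2 r, 0 < r & [set y | d x y < r] `<=` A
      & forall u : nat -> E,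
          (forall eps, 0 < eps ->
             exists N, forall m n, (N <= m)%N -> (N <= n)%N ->
               d (u m) (u n) < eps) ->
          exists x : E, u @ \oo --> x].

Notation borel E := (g_sigma_algebraType (@open E)).

Section bernstein.
Context {R : realType}.
Implicit Types (nu sigma : {measure set R -> \bar R}) (g h : R -> R).

Definition truncated_mass nu : \bar R :=
  (\int[nu]_(s in `]0%R, +oo[) (Num.min s 1)%:E)%E.

(* The integral is real-valued; it is finite as soon as
   truncated_mass nu < +oo. *)
Definition levy_khintchine (a b : R) nu (l : R) : R :=
  a + b * l + \int[nu]_(s in `]0, +oo[) (1 - expR (- (l * s))).

(* Functions on (0, +oo) are total functions whose values at l <= 0 are
   irrelevant. *)
Definition bernstein g : Prop :=
  exists (a b : R) (nu : {measure set R -> \bar R}),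
    [/\ 0 <= a, 0 <= b, (truncated_mass nu < +oo)%E
      & forall l, 0 < l -> g l = levy_khintchine a b nu l].

Definition stieltjes h : Prop :=
  exists (a b : R) (sigma : {measure set R -> \bar R}),
    [/\ 0 <= a, 0 <= b,
        (\int[sigma]_(s in `]0%R, +oo[) ((1 + s)^-1)%:E < +oo)%E
      & forall l, 0 < l ->
          h l = a / l + b + \int[sigma]_(s in `]0, +oo[) (l + s)^-1].

Definition thorin_bernstein g : Prop := bernstein g /\ stieltjes (derive1 g).

(* A measure on [0, +oo) is a measure on R not charging (-oo, 0). Its total
   mass may be less than 1 (killing). *)
Definition GGC (mu : {measure set R -> \bar R}) : Prop :=
  mu `]-oo, 0[%classic = 0%E /\
  exists2 g : R -> R, thorin_bernstein g &
    forall l, 0 < l ->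
      (\int[mu]_(x in `[0%R, +oo[) (expR (- (l * x)))%:E = (expR (- g l))%:E)%E.

End bernstein.

Section processes.
Context {R : realType} d (T : measurableType d) (P : probability T R).
Implicit Types (X e : R -> T -> \bar R).

(* mu is the law of the [0, +oo]-valued random variable Z restricted to
   [0, +oo): the mass of {Z = +oo} is lost. *)
Definition finite_law (Z : T -> \bar R) (mu : {measure set R -> \bar R}) :=
  measurable_fun [set: T] Z /\
  forall B : set R, measurable B ->
    mu B = P (Z @^-1` (EFin @` (B `&` `[0%R, +oo[%classic))).

Definition past X (s : R) : set (set T) :=
  <<s [set A | exists u, exists B : set (\bar R),
         [/\ 0 <= u, u <= s, measurable B & A = X u @^-1` B] ]>>.

(* Killed subordinators: +oo is the cemetery, the increments are stationary and
   independent of the past before killing, and expeR -oo = 0 on the killed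
   paths. On {X s = +oo} monotonicity gives X (s + t) - X s = +oo - +oo = -oo,
   which is not a real increment. *)
Record subordinator X (g : R -> R) : Prop := {
  subordinator_measurable :
    forall t, 0 <= t -> measurable_fun [set: T] (X t) ;
  subordinator0 : forall w, X 0 w = 0%E ;
  subordinator_nondecreasing :
    forall w s t, 0 <= s -> s <= t -> (X s w <= X t w)%E ;
  subordinator_right_continuous :
    forall w t, 0 <= t -> X s w @[s --> t^'+] --> X t w ;
  subordinator_increments :
    forall s t (A : set T) (B : set R), 0 <= s -> 0 <= t ->
      past X s A -> measurable B ->
      (P (A `&` [set w | X s w < +oo] `&`
          [set w | (EFin @` B) (X (s + t)%R w - X s w)])
       = P (A `&` [set w | X s w < +oo]) * P (X t @^-1` (EFin @` B)))%E ;
  subordinator_laplace :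
    forall t l, 0 <= t -> 0 < l ->
      (\int[P]_w expeR (- (l%:E * X t w)) = (expR (- (t * g l)))%:E)%E }.

(* Number of times s in A at which the point e s belongs to B. *)
Definition point_count e (A : set R) (B : set (\bar R)) (w : T) : \bar R :=
  counting [set s | A s /\ B (e s w)].

(* Poisson point process on (0, +oo] with characteristic measure phi. The
   value e s w = 0 encodes the absence of a point at time s. The second
   argument of poisson_prob is a dummy of the library; poisson_prob 0 is the
   Dirac mass at 0. *)
Definition poisson_point_process e (phi : set (\bar R) -> \bar R) : Prop :=
  (forall s w, 0 <= s -> (0 <= e s w)%E) /\
  forall (n : nat) (A : 'I_n -> set R) (B : 'I_n -> set (\bar R)),
    (forall i, [/\ measurable (A i), A i `<=` `[0, +oo[
                 & (lebesgue_measure (A i) < +oo)%E]) ->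
    (forall i, [/\ measurable (B i), B i `<=` [set x | (0 < x)%E]
                 & (phi (B i) < +oo)%E]) ->
    trivIset [set: 'I_n] (fun i => A i `*` B i) ->
    (forall i, measurable_fun [set: T] (point_count e (A i) (B i))) /\
    forall k : 'I_n -> nat,
      (P (\bigcap_(i in [set: 'I_n])
            [set w | point_count e (A i) (B i) w = (k i)%:R%:E])
       = \prod_(i < n)
           poisson_prob (fine (lebesgue_measure (A i) * phi (B i))) 0%N
             [set k i])%E.

End processes.

Section distributed_order.
Context {R : realType} d (E : measurableType d) (p : probability E R).
Variables (W : set E) (a b : E -> R) (nu : E -> {measure set R -> \bar R}).
Local Open Scope ereal_scope.

Definition mixed_characteristic_measure (B : set (\bar R)) : \bar R :=
  \int[p]_(y in W)
    (nu y (EFin @^-1` B `&` `]0%R, +oo[) + (a y)%:E * \d_(+oo) B).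

Definition distributed_order_subordinator (T : Type) (e : R -> T -> \bar R)
    (t : R) (w : T) : \bar R :=
  t%:E * (\int[p]_(y in W) (b y)%:E) + \esum_(s in `[0%R, t]) e s w.

End distributed_order.

(* Main.v *)
(* The Laplace exponent of the distributed order subordinator is the mixture of
   the exponents f(., y), and its derivative is the mixture of the derivatives
   f'(., y), which are Stieltjes functions because the laws of sigma^{f,y}(t)
   are in GGC. So the point is that a mixture of Stieltjes functions h_y is a
   Stieltjes function, where y |-> h_y(l) is measurable but nothing is assumed
   about the y-dependence of the representing measures. The substitution
   u = 1 / (1 + s) turns a Stieltjes representation into
   h_y(l) = int_[0,1] (1 + (l - 1) u)^-1 rho_y(du) with rho_y finite; the Taylor
   coefficients of h_y at l = 1 are, up to sign, the moments of rho_y, which are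
   thus measurable in y. As rays are bounded limits of polynomials on [0, 1],
   y |-> rho_y(B) is measurable for every Borel set B, and the mixture of the
   rho_y represents the mixture of the h_y.
   The Laplace transform of the sum over the Poisson point process is computed
   by approximating the jump sizes from below by simple functions, for which it
   involves finitely many independent Poisson variables. *)
Require Import Defs.
From HB Require Import structures.
From mathcomp Require Import all_boot all_order all_algebra.
From mathcomp Require Import all_classical all_reals all_analysis.
From mathcomp Require Import measurable_realfun ring lra.

Set Implicit Arguments.
Unset Strict Implicit.
Unset Printing Implicit Defensive.
Import Order.TTheory GRing.Theory Num.Theory.
Import numFieldNormedType.Exports.
Local Open Scope classical_set_scope.
Local Open Scope ring_scope.

(** * Mixtures of measures *)

Section mixture.
Local Open Scope ereal_scope.
Context {R : realType} d d' (X : measurableType d) (Y : measurableType d').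
Variables (m : {measure set X -> \bar R}) (D : set X) (mD : measurable D).
Variable k : X -> {measure set Y -> \bar R}.
Hypothesis mk : forall U, measurable U -> measurable_fun D (k ^~ U).

Definition mixture (U : set Y) : \bar R := \int[m]_(x in D) k x U.

Let mixture0 : mixture set0 = 0.
Proof. by rewrite /mixture integral0_eq. Qed.

Let mixture_ge0 U : 0 <= mixture U.
Proof. exact: integral_ge0. Qed.

Let mixture_sigma_additive : semi_sigma_additive mixture.
Proof.
move=> F mF tF mUF; rewrite [X in _ --> X](_ : _ =
    \int[m]_(x in D) (\sum_(0 <= n <oo) k x (F n))); last first.
  apply: eq_integral => x _.
  by apply/esym/cvg_lim => //; exact: measure_semi_sigma_additive.
rewrite integral_nneseries//; last by move=> n; exact: mk.
by apply: is_cvg_nneseries => n _ _; exact: integral_ge0.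
Qed.

HB.instance Definition _ := isMeasure.Build _ _ _ mixture
  mixture0 mixture_ge0 mixture_sigma_additive.

Definition mixture_measure : {measure set Y -> \bar R} := mixture.

Variable f : Y -> \bar R.
Hypotheses (f0 : forall y, 0 <= f y) (mf : measurable_fun setT f).

Import HBNNSimple.

Let f_ := nnsfun_approx measurableT mf.

Let cvg_f_ y : EFin \o f_ ^~ y @ \oo --> f y.
Proof. by apply: cvg_nnsfun_approx. Qed.

Let nd_f_ y : {homo (fun n => (f_ n y)%:E) : n p / (n <= p)%N >-> n <= p}.
Proof. by move=> n p np; rewrite lee_fin; exact/lefP/nd_nnsfun_approx. Qed.

Let integral_f_ (mu : {measure set Y -> \bar R}) :
  \int[mu]_y (f_ n y)%:E @[n --> \oo] --> \int[mu]_y f y.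
Proof.
rewrite (_ : \int[mu]_y f y = \int[mu]_y limn (fun n => (f_ n y)%:E)); last first.
  by apply: eq_integral => y _; apply/esym/cvg_lim => //; exact: cvg_f_.
apply: cvg_monotone_convergence => //.
- by move=> n; exact/measurable_EFinP.
- by move=> n y _; rewrite lee_fin.
Qed.

Let mint_f_ n : measurable_fun D (fun x => \int[k x]_y (f_ n y)%:E).
Proof.
under eq_fun do rewrite integralT_nnsfun sintegralE.
apply: emeasurable_fsum => // r.
by apply: measurable_funeM; exact: mk.
Qed.

(** For a simple function the integral is a finite combination of the masses of its level sets,
    measurable in [x] by [mk]; the general case is the limit along the approximations [f_ n]. *)
Lemma measurable_fun_integral_mixture :
  measurable_fun D (fun x => \int[k x]_y f y).
Proof.
apply: (emeasurable_fun_cvg _ _ mint_f_) => x _; exact: integral_f_.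
Qed.

(** For a simple function a finite sum is exchanged with the integral over [D]; monotone
    convergence, on both sides, passes to [f]. *)
Lemma ge0_integral_mixture :
  \int[mixture]_y f y = \int[m]_(x in D) \int[k x]_y f y.
Proof.
apply: (cvg_unique (@ereal_hausdorff R) (@integral_f_ mixture_measure)).
have -> : (fun n => \int[mixture_measure]_y (f_ n y)%:E) =
          (fun n => \int[m]_(x in D) \int[k x]_y (f_ n y)%:E).
  apply/funext => n; rewrite integralT_nnsfun sintegralE.
  transitivity (\int[m]_(x in D)
      (\sum_(r \in range (f_ n)) r%:E * k x (f_ n @^-1` [set r]))).
    rewrite ge0_integral_fsum//.
    - apply: eq_fsbigr => r rf; rewrite ge0_integralZl//; first exact: mk.
      by rewrite lee_fin; move: rf; rewrite inE => -[y _ <-].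
    - by move=> r; apply: measurable_funeM; exact: mk.
    - by move=> r x _; exact: nnsfun_mulemu_ge0.
  by apply: eq_integral => x _; rewrite integralT_nnsfun sintegralE.
rewrite (_ : \int[m]_(x in D) \int[k x]_y f y =
    \int[m]_(x in D) limn (fun n => \int[k x]_y (f_ n y)%:E)); last first.
  by apply: eq_integral => x _; apply/esym/cvg_lim => //; exact: integral_f_.
apply: cvg_monotone_convergence => //.
- by move=> n x _; apply: integral_ge0 => y _; rewrite lee_fin.
- move=> x _ n p np; apply: ge0_le_integral => //.
  + by move=> y _; rewrite lee_fin.
  + exact/measurable_EFinP.
  + exact/measurable_EFinP.
  + by move=> y _; exact: nd_f_.
Qed.

End mixture.

(** The image under [f] of the measure with density [w] is a mixture of weighted Dirac masses, so
    the change of variables becomes an instance of the mixture formula. *)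
Lemma transport_measure {R : realType} d d' (X : measurableType d)
    (Y : measurableType d') (m : {measure set X -> \bar R}) (D : set X)
    (w : X -> R) (f : X -> Y) :
  measurable D -> (forall x, D x -> 0 <= w x) -> measurable_fun D w ->
  measurable_fun D f ->
  exists mu : {measure set Y -> \bar R}, forall g : Y -> \bar R,
    (forall y, 0 <= g y)%E -> measurable_fun setT g ->
    (\int[mu]_y g y = \int[m]_(x in D) ((w x)%:E * g (f x)))%E.
Proof.
move=> mD w0 mw mf.
(* The norm makes the weight non-negative also outside [D], where the sign of [w] is unknown. *)
pose k (x : X) : {measure set Y -> \bar R} :=
  mscale (NngNum (normr_ge0 (w x))) (dirac (f x)).
have mk U : measurable U -> measurable_fun D (k ^~ U).
  move=> mU; apply: (emeasurable_funM (f := fun x => `|w x|%:E)).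
    by apply/measurable_EFinP; exact: measurableT_comp.
  exact: (measurableT_comp (@measurable_fun_dirac _ Y R setT U mU) mf).
exists (mixture_measure m mD mk) => g g0 mg.
rewrite (ge0_integral_mixture m mD mk g0 mg).
apply: eq_integral => x; rewrite inE => Dx.
rewrite ge0_integral_mscale// integral_dirac// diracT mul1e.
by rewrite /= ger0_norm// w0.
Qed.

(** * Test functions integrated against a family of finite measures on the unit interval *)

Section unit_interval_family.
Context {R : realType} d (Y : measurableType d).
Variable rho : Y -> {measure set R -> \bar R}.
Let I : set R := `[0, 1].
Hypothesis rho_fin : forall y, (rho y I < +oo)%E.

Let mI : measurable I. Proof. exact: measurable_itv. Qed.

(** A class of test functions that is a vector space and is closed under bounded pointwise limits;
    it is enlarged from Cauchy kernels to powers, polynomials and finally indicators of rays. *)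
Definition bounded_observable (f : R -> R) :=
  [/\ measurable_fun setT f, exists M : R, forall u, I u -> `|f u| <= M
    & measurable_fun setT (fun y => \int[rho y]_(u in I) (f u)%:E)%E].

Lemma bounded_observable_integrable f y : bounded_observable f ->
  (rho y).-integrable I (EFin \o f).
Proof.
move=> [mf [M fM] _]; apply: measurable_bounded_integrable => //.
  exact: measurable_funTS.
exists M; split; first by rewrite num_real.
by move=> N MN u /= /fM /le_trans; apply; exact: ltW.
Qed.

Lemma bounded_observableD f g :
  bounded_observable f -> bounded_observable g ->
  bounded_observable (fun u => f u + g u).
Proof.
move=> bf bg; have [mf [M fM] If] := bf; have [mg [N gN] Ig] := bg; split.
- exact: measurable_funD.
- by exists (M + N) => u Iu; rewrite (le_trans (ler_normD _ _))// lerD ?fM ?gN.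
- rewrite (_ : (fun y => _) = (fun y => \int[rho y]_(u in I) (f u)%:E +
    \int[rho y]_(u in I) (g u)%:E)%E); first exact: emeasurable_funD.
  apply/funext => y; rewrite -integralD_EFin//; exact: bounded_observable_integrable.
Qed.

Lemma bounded_observableZ c f :
  bounded_observable f -> bounded_observable (fun u => c * f u).
Proof.
move=> bf; have [mf [M fM] If] := bf; split.
- exact: measurable_funM.
- by exists (`|c| * M) => u Iu; rewrite normrM ler_wpM2l// fM.
- rewrite (_ : (fun y => _) = (fun y => c%:E * \int[rho y]_(u in I) (f u)%:E)%E).
    exact: measurable_funeM.
  apply/funext => y; rewrite -integralZl//.
  exact: bounded_observable_integrable.
Qed.

(** Dominated convergence for each [y]: the constant [M] is integrable because [rho y] has finite
    mass on the unit interval. *)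
Lemma bounded_observable_lim (f_ : nat -> R -> R) (f : R -> R) (M : R) :
  (forall n, bounded_observable (f_ n)) -> measurable_fun setT f ->
  (forall n u, I u -> `|f_ n u| <= M) ->
  (forall u, I u -> f_ ^~ u @ \oo --> f u) ->
  bounded_observable f.
Proof.
move=> bf mf fM f_f; split => //.
- exists M => u Iu; have /(@cvg_lim _) <- // : `|f_ n u| @[n --> \oo] --> `|f u|.
    by apply: cvg_norm; exact: f_f.
  by apply: limr_le => //; [apply: is_cvg_norm; apply/cvg_ex; exists (f u); exact: f_f|
    apply: nearW => n; exact: fM].
- apply: (emeasurable_fun_cvg (fun n y => \int[rho y]_(u in I) (f_ n u)%:E))%E.
    by move=> n; have [] := bf n.
  move=> y _; apply: (@dominated_cvg _ _ _ _ I mI _ _ (fun=> M%:E)) => //.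
  + by move=> n; apply/measurable_EFinP/measurable_funTS; have [] := bf n.
  + by move=> u Iu; apply: cvg_EFin; [exact: nearW|exact: f_f].
  + apply/integrableP; split => //; rewrite integral_cst//=.
    by rewrite lte_mul_pinfty.
Qed.

Lemma bounded_observable_sum (J : Type) (r : seq J) (F : J -> R -> R) :
  (forall j, bounded_observable (F j)) ->
  bounded_observable (fun u => \sum_(j <- r) F j u).
Proof.
move=> bF; elim: r => [|j r IH].
  under eq_fun do rewrite big_nil; split => //.
  - by exists 0 => u _; rewrite normr0.
  - rewrite (_ : (fun y => _) = cst 0%E)//.
    by apply/funext => y; rewrite integral0_eq.
under eq_fun do rewrite big_cons; exact: bounded_observableD.
Qed.

Lemma bounded_observable_horner (p : {poly R}) :
  (forall n, bounded_observable (fun u => u ^+ n)) ->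
  bounded_observable (fun u => p.[u]).
Proof.
move=> bX; under eq_fun do rewrite horner_coef.
apply: bounded_observable_sum => i; exact: bounded_observableZ.
Qed.

End unit_interval_family.

(** * Measurability of a family of measures from its Cauchy transforms *)

Lemma measurable_inv {R : realType} (D : set R) :
  measurable_fun D (GRing.inv : R -> R).
Proof.
(* Inversion is discontinuous at 0, so it is expressed through the power function, which is
   measurable everywhere; at 0 the factor [x] reproduces the convention that the inverse of 0 is
   0. *)
rewrite (_ : GRing.inv = fun x : R => x * (`|x| `^ (-1)) ^+ 2).
  apply: measurable_funTS; apply: measurable_funM => //.
  apply: measurable_funX; apply: (measurableT_comp (measurable_powR (-1))).
  exact: normr_measurable.
apply/funext => x; rewrite powR_inv1// exprVn real_normK ?num_real//.
by have [->|x0] := eqVneq x 0; rewrite ?invr0 ?mul0r// expr2 invfM mulrA divff// mul1r.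
Qed.

Lemma bernoulli_ineq {R : realType} (x : R) n : -1 <= x ->
  1 + n%:R * x <= (1 + x) ^+ n.
Proof.
move=> x1; elim: n => [|n IH]; first by rewrite mul0r addr0.
rewrite exprS; apply: (@le_trans _ _ ((1 + x) * (1 + n%:R * x))).
  have n0 : (0 : R) <= n%:R by [].
  by rewrite -natr1; nra.
by rewrite ler_wpM2l//; lra.
Qed.

(* With b_n ~ n c^(-n^2), the product b_n u^(n^2) tends to 0 if u < c and to
   infinity if u >= c. *)
Lemma cvg_ray_indic {R : realType} (c u : R) : 0 < c <= 1 -> 0 <= u <= 1 ->
  (1 - u ^+ (n.+1 ^ 2)) ^+ Num.truncn (n.+1%:R / c ^+ (n.+1 ^ 2)) @[n --> \oo]
    --> (\1_(`]-oo, c[%classic) u : R).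
Proof.
move=> /andP[c0 c1] /andP[u0 u1].
set f := (X in X @ \oo --> _).
pose N n := (n.+1 ^ 2)%N.
have cN0 n : 0 < c ^+ N n by rewrite exprn_gt0.
have cN1 n : c ^+ N n <= 1 by rewrite exprn_ile1// ltW.
have uN0 n : 0 <= u ^+ N n by rewrite exprn_ge0.
have uN1 n : u ^+ N n <= 1 by rewrite exprn_ile1.
pose b n := Num.truncn (n.+1%:R / c ^+ N n).
have bE n : (b n)%:R <= n.+1%:R / c ^+ N n < (b n).+1%:R.
  by apply: truncn_itv; rewrite divr_ge0// ltW.
have f0 n : 0 <= f n by rewrite /f exprn_ge0// subr_ge0; exact: uN1.
have f1 n : f n <= 1.
  by rewrite /f exprn_ile1 ?subr_ge0 ?lerBlDr ?lerDl//; [exact: uN1|exact: uN0].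
have [uc|cu] := ltP u c.
  rewrite indicE mem_set/= ?in_itv//=.
  pose del := c - u.
  have del0 : 0 < del by rewrite subr_gt0.
  (* Bernoulli bounds [1 + N del] by [(1 + del) ^ N], and [u (1 + del) <= c] since
     [c - u (1 + del) = (c - u) (1 - u)]. *)
  have h n : u ^+ N n * (1 + (N n)%:R * del) <= c ^+ N n.
    apply: (@le_trans _ _ ((u * (1 + del)) ^+ N n)).
      by rewrite exprMn ler_wpM2l// bernoulli_ineq// (le_trans _ (ltW del0)).
    by rewrite lerXn2r ?nnegrE//; [rewrite mulr_ge0//; lra|exact: ltW|rewrite /del; nra].
  (* Bernoulli gives [f n >= 1 - b n * u ^ N], and [h] with the choice of [b n] gives
     [b n * u ^ N <= 1 / (del (n + 1))]. *)
  apply: (@squeeze_cvgr _ _ _ _ (fun n => 1 - del^-1 * harmonic n) (cst 1)).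
  - apply: nearW => n; rewrite f1 andbT.
    apply: (@le_trans _ _ (1 + (b n)%:R * (- u ^+ N n))); last first.
      by apply: bernoulli_ineq; rewrite lerN2.
    rewrite mulrN lerD2l lerN2 /harmonic/=.
    have /andP[bn _] := bE n.
    rewrite -invfM -[leRHS]mul1r ler_pdivlMr ?mulr_gt0//.
    have M0 : 0 < (N n)%:R * del by rewrite mulr_gt0// ltr0n expn_gt0.
    have : (b n)%:R * c ^+ N n <= n.+1%:R by rewrite -ler_pdivlMr.
    have := h n.
    have NE : (N n)%:R = n.+1%:R * n.+1%:R :> R by rewrite /N natrX expr2.
    move: M0; rewrite NE.
    have n1 : 0 < n.+1%:R :> R by [].
    have b0 : 0 <= (b n)%:R :> R by [].
    move: (uN0 n) (cN0 n) n1 b0 del0.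
    move: (u ^+ N n) (c ^+ N n) (n.+1%:R : R) ((b n)%:R : R) (del) => x y m B D.
    move=> x0 y0 m0 B0 D0 M0 H1 H2.
    have H3 : B * (x * (1 + m * m * D)) <= m.
      by rewrite (le_trans _ H2)// ler_wpM2l.
    have H4 : m * (B * x * (D * m)) <= m * 1.
      rewrite mulr1 (le_trans _ H3)//; have := mulr_ge0 B0 x0; nra.
    by move: H4; rewrite ler_pM2l.
  - rewrite -[X in _ --> X]subr0; apply: cvgB; first exact: cvg_cst.
    by rewrite -(mulr0 del^-1); apply: cvgMr; exact: cvg_harmonic.
  - exact: cvg_cst.
rewrite indicE memNset/=; last by rewrite in_itv/=; apply/negP; rewrite -leNgt.
apply: (@squeeze_cvgr _ _ _ _ (cst 0) harmonic).
- apply: nearW => n; rewrite f0/=.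
  have /andP[_ bn] := bE n.
  (* Truncation costs less than 1 in [b n], hence less than [c ^ N <= 1] after multiplication; this
     turns [n + 1] into [n]. *)
  have bu : n%:R <= (b n)%:R * u ^+ N n.
    apply: (@le_trans _ _ ((b n)%:R * c ^+ N n)).
      move: bn; rewrite ltr_pdivrMr// -natr1 -[X in _ < X * _]natr1.
      move: (cN0 n) (cN1 n) => x0 x1 H.
      by lra.
    by rewrite ler_wpM2l// lerXn2r// ?nnegrE// ltW.
  rewrite /harmonic/= -[leRHS]mul1r ler_pdivlMr//.
  (* The product of [(1 - u ^ N) ^ b] and [(1 + u ^ N) ^ b] is at most 1, and Bernoulli bounds the
     second factor below by [1 + b u ^ N >= n + 1]. *)
  apply: (@le_trans _ _ (f n * (1 + u ^+ N n) ^+ b n)).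
    rewrite ler_wpM2l//; apply: le_trans (bernoulli_ineq _ _); last first.
      by rewrite (le_trans _ (uN0 n)).
    by rewrite -natr1 addrC lerD2l.
  rewrite -exprMn exprn_ile1//.
    by rewrite mulr_ge0 ?subr_ge0 ?addr_ge0//; exact: uN1.
  by rewrite -subr_sqr expr1n lerBlDr lerDl sqr_ge0.
- exact: cvg_cst.
- exact: cvg_harmonic.
Qed.

(** * From Cauchy kernels to moments, and from moments to Borel sets *)

Section cauchy_kernel_family.
Context {R : realType} d (Y : measurableType d).
Variable rho : Y -> {measure set R -> \bar R}.
Let I : set R := `[0, 1].
Hypothesis rho_fin : forall y, (rho y I < +oo)%E.
Hypothesis mrho : forall l, 0 < l -> measurable_fun setT
  (fun y => \int[rho y]_(u in I) ((1 + (l - 1) * u)^-1)%:E)%E.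

Let mI : measurable I. Proof. exact: measurable_itv. Qed.

Let bo_kernel l : 0 < l ->
  bounded_observable rho (fun u => (1 + (l - 1) * u)^-1).
Proof.
move=> l0; split; last exact: mrho.
  have mf : measurable_fun setT (fun u : R => 1 + (l - 1) * u).
    by apply: measurable_funD => //; exact: measurable_funM.
  exact: (measurableT_comp (@measurable_inv R setT) mf).
(* The denominator [1 + (l - 1) u] is a convex combination of 1 and [l], hence at least their
   minimum. *)
exists (Num.min 1 l)^-1 => u; rewrite /I/= in_itv/= => /andP[u0 u1].
have m0 : 0 < Num.min 1 l by rewrite lt_min ltr01.
have ml : Num.min 1 l <= 1 + (l - 1) * u.
  rewrite ge_min; case: (lerP 1 l) => l1; apply/orP; [left|right]; nra.
rewrite ger0_norm ?invr_ge0; last by rewrite (le_trans _ ml)// ltW.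
by rewrite lef_pV2// posrE// (lt_le_trans _ ml).
Qed.

(** Strong induction: with the lower powers available, the [n]-th power is a bounded limit of
    divided Taylor remainders of the kernel at [l = 1]. *)
Lemma bounded_observable_exprn n : bounded_observable rho (fun u => u ^+ n).
Proof.
elim/ltn_ind: n => n IH.
(* The remainder of order n in eps of (1 - eps u)^-1, divided by eps^n, is
   u^n / (1 - eps u). *)
pose eps k : R := harmonic k.+1.
have eps0 k : 0 < eps k by rewrite invr_gt0.
(* The shifted index starts [eps] at 1/2, which keeps [l = 1 - eps k] positive and [1 - eps k * u]
   at least 1/2; hence the uniform bound 2 below. *)
have eps2 k : eps k <= 2^-1 by rewrite lef_pV2 ?posrE// ler_nat.
pose g k u := (eps k) ^- n * ((1 + ((1 - eps k) - 1) * u)^-1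
  + \sum_(i < n) (- (eps k) ^+ i) * u ^+ i).
have den k u : I u -> 2^-1 <= 1 - eps k * u.
  rewrite /I/= in_itv/= => /andP[u0 u1].
  by have := eps2 k; have := eps0 k; nra.
have gE k u : I u -> g k u = u ^+ n * (1 - eps k * u)^-1.
  move=> Iu; have d0 := den k u Iu.
  have d1 : 1 - eps k * u != 0 by rewrite gt_eqF// (lt_le_trans _ d0)// invr_gt0.
  have e1 : eps k ^+ n != 0 by rewrite expf_neq0// gt_eqF.
  rewrite /g; under eq_bigr do rewrite mulNr -exprMn.
  rewrite sumrN (_ : 1 + (1 - eps k - 1) * u = 1 - eps k * u); last by ring.
  have : (eps k * u) ^+ n - 1 = (eps k * u - 1) * \sum_(i < n) (eps k * u) ^+ i.
    by rewrite subrX1.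
  move: (\sum_(i < n) _) => S; rewrite exprMn.
  move: e1 d1; move: (eps k ^+ n) (u ^+ n) => E U e1 d1 HS.
  have -> : S = (1 - E * U) / (1 - eps k * u).
    by apply: (mulIf d1); rewrite divfK// -[RHS]opprB HS; ring.
  by field; rewrite d1.
apply: (@bounded_observable_lim _ _ _ rho rho_fin g _ 2).
- move=> k; apply: bounded_observableZ => //; apply: bounded_observableD => //.
    by apply: bo_kernel; rewrite subr_gt0 (le_lt_trans (eps2 k))// invf_lt1// ltr1n.
  by apply: bounded_observable_sum => // i; apply: bounded_observableZ => //; exact: IH.
- exact: exprn_measurable.
- move=> k u Iu; rewrite gE//; have d0 := den k u Iu.
  move: (Iu); rewrite /I/= in_itv/= => /andP[u0 u1].
  have d2 : 0 < 1 - eps k * u by rewrite (lt_le_trans _ d0)// invr_gt0.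
  rewrite ger0_norm; last by rewrite divr_ge0// ?exprn_ge0// ltW.
  rewrite -[leRHS]mul1r ler_pM ?exprn_ge0 ?exprn_ile1 ?invr_ge0 ?(ltW d2)//.
  by rewrite -[leRHS]invrK lef_pV2 ?posrE.
- move=> u Iu; rewrite (_ : g^~ u = fun k => u ^+ n * (1 - eps k * u)^-1); last first.
    by apply/funext => k; rewrite gE.
  rewrite -[X in _ --> X]mulr1; apply: cvgMr.
  rewrite -[X in _ --> X]invr1; apply: cvgV => //.
  rewrite -[X in _ --> X]subr0; apply: cvgB; first exact: cvg_cst.
  rewrite -(mul0r u); apply: cvgMl.
  by have := @cvg_harmonic R; rewrite -(@cvg_shiftS R).
Qed.

(** A pi-lambda argument: the sets with measurable mass form a lambda-system, proper differences
    being handled by the finiteness of [rho y], and it contains the rays, which are stable under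
    intersection and generate the Borel sets. *)
Lemma measurable_unit_interval_family B : measurable B ->
  measurable_fun setT (fun y => rho y (B `&` I)).
Proof.
pose H := [set A : set R | measurable A /\
  measurable_fun setT (fun y => rho y (A `&` I))].
have HT : H setT.
  split => //; have [_ _] := bounded_observable_exprn 0.
  rewrite (_ : (fun y => _) = fun y => rho y (setT `&` I))//.
  apply/funext => y; under eq_integral do rewrite expr0.
  by rewrite integral_cst// mul1e setTI.
have Hray : @RGenInftyO.G R `<=` H.
  move=> _ [c ->]; split; first exact: measurable_itv.
  have [c0|c0] := leP c 0.
    rewrite (_ : (fun y => _) = cst 0%E)//; apply/funext => y.
    rewrite (_ : _ `&` _ = set0) ?measure0// -subset0 => u [/=].
    by rewrite /I/= !in_itv/= => uc /andP[u0 _]; lra.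
  have [c1|c1] := leP c 1; last first.
    case: HT => _; rewrite (_ : (fun y => _) = fun y => rho y (`]-oo, c[ `&` I))//.
    apply/funext => y; congr (rho y _); rewrite setTI; apply/seteqP; split => u.
      by move=> Iu; split => //; move: Iu; rewrite /I/= !in_itv/=; lra.
    by case.
  (* The polynomials of [cvg_ray_indic] are bounded by 1 on the unit interval and converge pointwise
     to the indicator. *)
  have [_ _] : bounded_observable rho (\1_(`]-oo, c[%classic) : R -> R).
    apply: (@bounded_observable_lim _ _ _ rho rho_fin
      (fun n u => (1 - u ^+ (n.+1 ^ 2)) ^+ Num.truncn (n.+1%:R / c ^+ (n.+1 ^ 2))) _ 1).
    - move=> n; pose p : {poly R} :=
        (1 - 'X^(n.+1 ^ 2)) ^+ Num.truncn (n.+1%:R / c ^+ (n.+1 ^ 2)).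
      rewrite (_ : (fun u => _) = fun u => p.[u]); last first.
        by apply/funext => u; rewrite /p !hornerE.
      by apply: bounded_observable_horner => //; exact: bounded_observable_exprn.
    - exact: measurable_indic.
    - move=> n u; rewrite /I/= in_itv/= => /andP[u0 u1].
      have uN0 : 0 <= u ^+ (n.+1 ^ 2) by rewrite exprn_ge0.
      have uN1 : u ^+ (n.+1 ^ 2) <= 1 by rewrite exprn_ile1.
      by rewrite normrX exprn_ile1// ger0_norm ?subr_ge0// lerBlDr lerDl.
    - by move=> u; rewrite /I/= in_itv/= => u01; apply: cvg_ray_indic => //; rewrite c0.
  rewrite (_ : (fun y => _) = fun y => rho y (`]-oo, c[ `&` I))//.
  by apply/funext => y; rewrite integral_indic.
suff GH : (@RGenInftyO.G R).-sigma.-measurable `<=` H.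
  by move=> mB; apply: (GH B _).2; rewrite -RGenInftyO.measurableE.
apply: lambda_system_subset => //.
- move=> _ _ [x ->] [y ->]; exists (Num.min x y).
  by apply/seteqP; split => u /=; rewrite !in_itv/= lt_min => /andP.
- split => //.
  + move=> A B' BA [mA hA] [mB' hB']; split; first exact: measurableD.
    rewrite (_ : (fun y => _) = fun y => rho y (A `&` I) - rho y (B' `&` I))%E.
      exact: emeasurable_funB.
    apply/funext => y.
    rewrite (_ : (A `\` B') `&` I = (A `&` I) `\` (B' `&` I)); last first.
      by apply/seteqP; split => u /=; tauto.
    rewrite measureD ?(setIidr (setSI BA))//; last 3 first.
    * exact: measurableI.
    * exact: measurableI.
    * rewrite (le_lt_trans _ (rho_fin y))// le_measure ?inE//.
      exact: measurableI.
  + move=> F ndF HF; split; first by apply: bigcup_measurable => n _; case: (HF n).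
    apply: (emeasurable_fun_cvg (fun n y => rho y (F n `&` I))) => //.
      by move=> n; case: (HF n).
    move=> y _; rewrite setI_bigcupl; apply: nondecreasing_cvg_mu.
    * by move=> n; apply: measurableI => //; case: (HF n).
    * by apply: bigcup_measurable => n _; apply: measurableI => //; case: (HF n).
    * by move=> n m nm; apply/subsetPset; apply: setSI; apply/subsetPset; exact: ndF.
Qed.

End cauchy_kernel_family.

(** * Stieltjes functions *)

Section stieltjes_unit_interval.
Context {R : realType}.
Implicit Types (h : R -> R) (rho : {measure set R -> \bar R}).
Local Notation I := (`[0%R, 1%R]%classic : set R).

Lemma measurable_cauchy_kernel (l : R) (D : set R) :
  measurable_fun D (fun u : R => ((1 + (l - 1) * u)^-1)%:E).
Proof.
apply/measurable_EFinP; apply: measurable_funTS.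
have mf : measurable_fun setT (fun u : R => 1 + (l - 1) * u).
  by apply: measurable_funD => //; exact: measurable_funM.
exact: (measurableT_comp (@measurable_inv R setT) mf).
Qed.

Lemma cauchy_kernel_gt0 (l u : R) : 0 < l -> I u -> 0 < 1 + (l - 1) * u.
Proof.
rewrite /= in_itv/= => l0 /andP[u0 u1].
by have [l1|l1] := lerP 1 l; nra.
Qed.

Lemma measurable_resolvent (l : R) (D : set R) :
  measurable_fun D (fun s : R => ((l + s)^-1)%:E).
Proof.
apply/measurable_EFinP; apply: measurable_funTS.
have mf : measurable_fun setT (fun s : R => l + s) by exact: measurable_funD.
exact: (measurableT_comp (@measurable_inv R setT) mf).
Qed.

(** The form of [transport_measure] suited to substitutions between []0, +oo[] and the unit
    interval: the test function is only controlled on the target [D'] and is extended by 0. *)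
Lemma ge0_transport_measure (m : {measure set R -> \bar R}) (D D' : set R)
    (w f : R -> R) :
  measurable D -> measurable D' -> (forall x, D x -> 0 <= w x) ->
  measurable_fun D w -> measurable_fun D f -> (forall x, D x -> D' (f x)) ->
  exists mu : {measure set R -> \bar R}, forall g : R -> \bar R,
    (forall y, D' y -> 0 <= g y)%E -> measurable_fun D' g ->
    (\int[mu]_(y in D') g y = \int[m]_(x in D) ((w x)%:E * g (f x)))%E.
Proof.
move=> mD mD' w0 mw mf fD.
have [mu muE] := transport_measure m mD w0 mw mf.
exists mu => g g0 mg; rewrite integral_mkcond muE.
- apply: eq_integral => x; rewrite inE => Dx; congr (_ * _)%E.
  by rewrite patchE mem_set//; exact: fD.
- by move=> y; rewrite patchE; case: ifPn => //; rewrite inE; exact: g0.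
- exact: (measurable_restrictT _ mD').1 mg.
Qed.

(** With [u = 1 / (1 + s)] one has [1 / (l + s) = u / (1 + (l - 1) u)], and the density
    [1 / (1 + s)] makes the image of [sigma] finite. The kernel equals [1 / l] at [u = 1] and 1 at
    [u = 0], so [a / l] and [b] become atoms at these endpoints. *)
Lemma stieltjes_unit_measure h : stieltjes h ->
  exists2 rho : {measure set R -> \bar R}, (rho I < +oo)%E & forall l, 0 < l ->
    (\int[rho]_(u in I) ((1 + (l - 1) * u)^-1)%:E = (h l)%:E)%E.
Proof.
move=> [a [b [sigma [a0 b0 sfin hE]]]].
have mI : measurable I by exact: measurable_itv.
have mP : measurable (`]0, +oo[%classic : set R) by exact: measurable_itv.
have mf : measurable_fun (`]0, +oo[ : set R) (fun s : R => (1 + s)^-1).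
  by apply/measurable_EFinP; exact: measurable_resolvent.
have f0 (s : R) : `]0, +oo[%classic s -> 0 <= (1 + s)^-1.
  by rewrite /= in_itv/= andbT => s0; rewrite invr_ge0; lra.
have [|mu muE] := ge0_transport_measure sigma mP mI f0 mf mf.
  move=> s /[dup] s0 /f0; rewrite /= in_itv/= => ->/=.
  move: s0; rewrite /= in_itv/= andbT => s0.
  by rewrite invf_le1 ?lerDl ?ltW// addr_gt0.
pose rho : {measure set R -> \bar R} := measure_add mu
  (measure_add (mscale (NngNum a0) \d_(1 : R)) (mscale (NngNum b0) \d_(0 : R))).
have rhoE (g : R -> R) : (forall u, I u -> 0 <= g u) ->
    measurable_fun I (EFin \o g) ->
    (\int[rho]_(u in I) (g u)%:E =
     \int[sigma]_(s in `]0%R, +oo[) ((1 + s)^-1 * g ((1 + s)^-1))%:E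
     + (a * g 1 + b * g 0)%:E)%E.
  move=> g0 mg.
  rewrite ge0_integral_measure_add//.
  rewrite ge0_integral_measure_add//.
  rewrite muE//; congr (_ + _)%E.
  rewrite !ge0_integral_mscale// !integral_dirac//=.
  by rewrite !diracE !mem_set/= ?mul1e ?EFinD ?EFinM// in_itv/= ?lexx ?ler01.
exists rho => [|l l0].
  have -> : rho I = (\int[rho]_(u in I) (1 : R)%:E)%E by rewrite integral_cst// mul1e.
  rewrite rhoE//; last exact/measurable_EFinP.
  rewrite lte_add_pinfty ?ltry//.
  by under eq_integral do rewrite mulr1.
rewrite rhoE.
- have kE (s : R) : s \in (`]0, +oo[%classic : set R) ->
      ((1 + s)^-1 * (1 + (l - 1) * (1 + s)^-1)^-1)%:E = ((l + s)^-1)%:E.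
    rewrite inE/= in_itv/= andbT => s0; congr EFin; field.
    by rewrite !gt_eqF//; lra.
  under eq_integral => s sP do rewrite kE//.
  rewrite hE// mulr1 mulr0 addr0 invr1 mulr1 (addrC 1) subrK.
  rewrite addeC [RHS]EFinD; congr (_ + _)%E.
  rewrite /Rintegral fineK// ge0_fin_numE; last first.
    apply: integral_ge0 => s; rewrite /= in_itv/= andbT => s0.
    by rewrite lee_fin invr_ge0; lra.
  (* Finiteness is needed to remove [fine] from the real-valued integral; this [c] satisfies
     [1 + s <= c (l + s)], which compares the integrand with [1 / (1 + s)]. *)
  pose c := Num.max 1 l^-1.
  apply: (@le_lt_trans _ _ (c%:E * \int[sigma]_(s in `]0%R, +oo[) ((1 + s)^-1)%:E)%E).
    have c0 : 0 <= c by rewrite le_max ler01.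
    rewrite -ge0_integralZl_EFin//; last exact: measurable_resolvent.
    apply: ge0_le_integral => //.
    + by move=> s; rewrite /= in_itv/= andbT => s0; rewrite lee_fin invr_ge0; lra.
    + exact: measurable_resolvent.
    + by apply: measurable_funeM; exact: measurable_resolvent.
    + move=> s; rewrite /= in_itv/= andbT => s0; rewrite lee_fin.
      rewrite ler_pdivlMr; last lra.
      rewrite mulrC ler_pdivrMr; last lra.
      have : 1 <= c by rewrite le_max lexx.
      have : 1 <= c * l by rewrite -ler_pdivrMr// mul1r le_max lexx orbT.
      by nra.
  by rewrite lte_mul_pinfty// lee_fin le_max ler01.
- by move=> u Iu; rewrite invr_ge0 ltW// cauchy_kernel_gt0.
- exact: measurable_cauchy_kernel.
Qed.

(** The inverse substitution [s = 1 / u - 1] on the open interval, with weight [1 / u]; the atoms of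
    [rho] at 1 and 0 give back the coefficients of [1 / l] and of the constant. *)
Lemma unit_measure_stieltjes h rho : (rho I < +oo)%E ->
  (forall l, 0 < l ->
    (\int[rho]_(u in I) ((1 + (l - 1) * u)^-1)%:E = (h l)%:E)%E) ->
  stieltjes h.
Proof.
move=> rhofin hE.
have mI : measurable I by exact: measurable_itv.
have mO : measurable (`]0, 1[%classic : set R) by exact: measurable_itv.
have mP : measurable (`]0, +oo[%classic : set R) by exact: measurable_itv.
have fin_rho A : measurable A -> A `<=` I -> rho A \is a fin_num.
  move=> mA AI; rewrite ge0_fin_numE// (le_lt_trans _ rhofin)//.
  by rewrite le_measure ?inE.
have rhofin1 : rho [set 1] \is a fin_num.
  by apply: fin_rho => // u ->; rewrite /= in_itv/= lexx ler01.
have rhofin0 : rho [set 0] \is a fin_num.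
  by apply: fin_rho => // u ->; rewrite /= in_itv/= lexx ler01.
have rhofinO : rho (`]0, 1[%classic : set R) \is a fin_num.
  by apply: fin_rho => // u /=; rewrite !in_itv/= => /andP[/ltW -> /ltW ->].
have w0 (u : R) : `]0, 1[%classic u -> 0 <= u^-1.
  by rewrite /= in_itv/= => /andP[u0 _]; rewrite invr_ge0 ltW.
have mw : measurable_fun (`]0, 1[ : set R) (GRing.inv : R -> R) by exact: measurable_inv.
have mf : measurable_fun (`]0, 1[ : set R) (fun u : R => u^-1 - 1).
  exact: measurable_funB.
have [|mu muE] := ge0_transport_measure rho mO mP w0 mw mf.
  move=> u; rewrite /= !in_itv/= andbT => /andP[u0 u1].
  by rewrite subr_gt0 invf_gt1.
have resE l : 0 < l ->
    (\int[mu]_(s in `]0%R, +oo[) ((l + s)^-1)%:E =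
     \int[rho]_(u in `]0%R, 1%R[) ((1 + (l - 1) * u)^-1)%:E)%E.
  move=> l0; rewrite muE; last 2 first.
  - by move=> s; rewrite /= in_itv/= andbT => s0; rewrite lee_fin invr_ge0; lra.
  - exact: measurable_resolvent.
  apply: eq_integral => u; rewrite inE/= in_itv/= => /andP[u0 u1].
  rewrite -EFinM; congr EFin; field.
  have k0 : 0 < 1 + (l - 1) * u by apply: cauchy_kernel_gt0 => //=; rewrite in_itv/= !ltW.
  rewrite (gt_eqF u0)/= andbT.
  by rewrite gt_eqF.
exists (fine (rho [set 1])), (fine (rho [set 0])), mu; split.
- exact: fine_ge0.
- exact: fine_ge0.
(* The Stieltjes integrability condition is the case [l = 1], where the kernel is constantly 1 and
   the integral is the mass of the open interval. *)
- rewrite resE//; under eq_integral do rewrite subrr mul0r addr0 invr1.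
  by rewrite integral_cst// mul1e ltey_eq rhofinO.
- move=> l l0.
  have int1 x : (\int[rho]_(u in [set x]) ((1 + (l - 1) * u)^-1)%:E =
      ((1 + (l - 1) * x)^-1)%:E * rho [set x])%E.
    by rewrite -integral_cst//; apply: eq_integral => u; rewrite inE => ->.
  have k0 := @cauchy_kernel_gt0 l _ l0.
  have IE : I = [set 0] `|` (`]0, 1[ `|` [set 1]).
    apply/seteqP; split => u /=; rewrite !in_itv/=.
      move=> /andP[]; rewrite !le_eqVlt => /predU1P[<-|u0]; first by left.
      by move=> /predU1P[->|u1]; right; [right|left; rewrite u0].
    by move=> [->|[/andP[/ltW -> /ltW ->]|->]]//; rewrite lexx ler01.
  apply: EFin_inj; rewrite -hE// IE ge0_integral_setU//; last 4 first.
  - by apply: measurableU.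
  - exact: measurable_cauchy_kernel.
  - by rewrite -IE => u Iu; rewrite lee_fin invr_ge0 ltW// k0.
  - rewrite disj_set2E; apply/eqP; rewrite -subset0 => u /= [->].
    by rewrite in_itv/= ltxx/= => -[//|/eqP]; rewrite eq_sym oner_eq0.
  rewrite ge0_integral_setU//; last 3 first.
  - exact: measurable_cauchy_kernel.
  - move=> u hu; rewrite lee_fin invr_ge0 ltW// k0//.
    by rewrite IE; right.
  - rewrite disj_set2E; apply/eqP; rewrite -subset0 => u /= [+ u1].
    by rewrite u1 in_itv/= ltxx andbF.
  rewrite !int1 -resE// mulr1 mulr0 addr0 invr1 (addrC 1) subrK mul1e.
  rewrite !EFinD EFinM !fineK//.
    rewrite addeCA addeC; congr (_ + _)%E.
    by rewrite addeC muleC.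
  rewrite resE// ge0_fin_numE; last first.
    apply: integral_ge0 => u /= hu; rewrite lee_fin invr_ge0 ltW// k0//.
    by rewrite IE; right; left.
  apply: (@le_lt_trans _ _ (\int[rho]_(u in I) ((1 + (l - 1) * u)^-1)%:E)%E).
    apply: ge0_subset_integral => //.
    + exact: measurable_cauchy_kernel.
    + by move=> u Iu; rewrite lee_fin invr_ge0 ltW// k0.
    + by rewrite IE => u hu; right; left.
  by rewrite hE// ltry.
Qed.

(** The representing measures are merely chosen for each [y]; their measurability in [y] is
    recovered from that of the functions [h y], after which they can be mixed. *)
Lemma stieltjes_mixture d (Y : measurableType d) (m : {measure set Y -> \bar R})
    (D : set Y) (h : Y -> R -> R) (H : R -> R) :
  measurable D -> (forall y, stieltjes (h y)) ->
  (forall l, 0 < l -> measurable_fun setT (h ^~ l)) ->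
  (forall l, 0 < l -> (\int[m]_(y in D) (h y l)%:E = (H l)%:E)%E) ->
  stieltjes H.
Proof.
move=> mD sh mh HE.
have mI : measurable I by exact: measurable_itv.
have /choice[rho /all_and2[rhofin rhoE]] :
    forall y, exists rho : {measure set R -> \bar R},
    (rho I < +oo)%E /\ forall l, 0 < l ->
    (\int[rho]_(u in I) ((1 + (l - 1) * u)^-1)%:E = (h y l)%:E)%E.
  by move=> y; have [rho ? ?] := stieltjes_unit_measure (sh y); exists rho.
have mrho := @measurable_unit_interval_family R _ Y rho rhofin.
(* The restriction is what is known to depend measurably on [y]; [rho y] is not controlled outside
   the unit interval. *)
pose k y : {measure set R -> \bar R} := mrestr (rho y) mI.
have mk U : measurable U -> measurable_fun D (k ^~ U).
  move=> mU; apply: measurable_funTS; apply: mrho => // l l0.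
  by under eq_fun do rewrite rhoE//; apply/measurable_EFinP; exact: mh.
have mixE l : 0 < l ->
    (\int[mixture_measure m mD mk]_(u in I) ((1 + (l - 1) * u)^-1)%:E = (H l)%:E)%E.
  move=> l0; rewrite integral_mkcond ge0_integral_mixture//.
  - rewrite -HE//; apply: eq_integral => y _; rewrite -rhoE// -integral_mkcond.
    apply: eq_measure_integral => A mA AI.
    by rewrite /k /= /mrestr setIidl.
  - move=> u; rewrite patchE; case: ifPn => //; rewrite inE => Iu.
    by rewrite lee_fin invr_ge0 ltW// cauchy_kernel_gt0.
  - by apply: (measurable_restrictT _ mI).1; exact: measurable_cauchy_kernel.
apply: (@unit_measure_stieltjes H (mixture_measure m mD mk)) => //.
(* At [l = 1] the kernel is 1, so the total mass of the mixture is the finite number [H 1]. *)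
have := mixE _ ltr01; under eq_integral do rewrite subrr mul0r addr0 invr1.
by rewrite integral_cst// mul1e => ->; rewrite ltry.
Qed.

End stieltjes_unit_interval.

(** * Lévy-Khintchine exponents *)

Section levy_khintchine_theory.
Context {R : realType}.
Implicit Types (nu : {measure set R -> \bar R}) (l : R).
Local Notation Rpos := (`]0%R, +oo[%classic : set R).

Lemma measurable_Rpos : measurable Rpos.
Proof. exact: measurable_itv. Qed.
Hint Resolve measurable_Rpos : core.

Lemma measurable_expRNM l (D : set R) :
  measurable_fun D (fun s : R => expR (- (l * s))).
Proof.
apply: measurable_funTS; apply: (measurableT_comp (@measurable_expR R)).
by apply: measurableT_comp => //; exact: measurable_funM.
Qed.

Lemma measurable_one_sub_expR l (D : set R) :
  measurable_fun D (fun s : R => (1 - expR (- (l * s)))%:E).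
Proof.
apply/measurable_EFinP; apply: measurable_funB => //.
exact: measurable_expRNM.
Qed.

Lemma measurable_mul_expR l (D : set R) :
  measurable_fun D (fun s : R => (s * expR (- (l * s)))%:E).
Proof.
apply/measurable_EFinP; apply: measurable_funM => //.
exact: measurable_expRNM.
Qed.

Lemma one_sub_expR_ge0 l s : 0 < l -> Rpos s -> 0 <= 1 - expR (- (l * s)).
Proof.
rewrite /= in_itv/= andbT => l0 s0.
by rewrite subr_ge0 expR_le1 oppr_le0 mulr_ge0// ltW.
Qed.

Lemma mul_expR_ge0 l s : Rpos s -> 0 <= s * expR (- (l * s)).
Proof. by rewrite /= in_itv/= andbT => s0; rewrite mulr_ge0 ?expR_ge0// ltW. Qed.

(** For [s <= 1] by [1 - e^(-x) <= x], for [s > 1] by the trivial bound 1. Domination by [min s 1]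
    gives integrability from a finite truncated mass. *)
Lemma one_sub_expR_le l s : 0 < l -> Rpos s ->
  1 - expR (- (l * s)) <= Num.max 1 l * Num.min s 1.
Proof.
rewrite /= in_itv/= andbT => l0 s0.
have e0 := expR_gt0 (- (l * s)).
have := expR_ge1Dx (- (l * s)).
have l1 : l <= Num.max 1 l by rewrite le_max lexx orbT.
have l2 : 1 <= Num.max 1 l by rewrite le_max lexx.
by have [s1|s1] := leP s 1; nra.
Qed.

(** For [s <= 1] the exponential is at most 1; for [s > 1] the inequality [l s <= e^(l s)] bounds
    the left side by [1 / l]. *)
Lemma mul_expR_le l s : 0 < l -> Rpos s ->
  s * expR (- (l * s)) <= Num.max 1 l^-1 * Num.min s 1.
Proof.
rewrite /= in_itv/= andbT => l0 s0.
have e0 := expR_gt0 (- (l * s)).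
have e1 : expR (- (l * s)) <= 1 by rewrite expR_le1 oppr_le0 mulr_ge0// ltW.
have l1 : l^-1 <= Num.max 1 l^-1 by rewrite le_max lexx orbT.
have l2 : 1 <= Num.max 1 l^-1 by rewrite le_max lexx.
have li : 0 < l^-1 by rewrite invr_gt0.
have [s1|s1] := leP s 1; first by nra.
rewrite mulr1; apply: (le_trans _ l1).
rewrite expRN ler_pdivrMr ?expR_gt0// ler_pdivlMl//.
by apply: le_trans (expR_ge1Dx _); rewrite lerDr.
Qed.

Lemma integrable_min_one nu : (truncated_mass nu < +oo)%E ->
  nu.-integrable Rpos (fun s => (Num.min s 1)%:E).
Proof.
move=> nufin; apply/integrableP; split.
  by apply/measurable_EFinP; exact: measurable_minr.
rewrite (le_lt_trans _ nufin)// le_eqVlt; apply/orP; left; apply/eqP.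
apply: eq_integral => s; rewrite inE/= in_itv/= andbT => s0.
by rewrite ger0_norm// le_min ler01 ltW.
Qed.

Lemma integrable_dominated_min_one nu (f : R -> R) (c : R) :
  (truncated_mass nu < +oo)%E -> measurable_fun Rpos (EFin \o f) ->
  (forall s, Rpos s -> `|f s| <= c * Num.min s 1) ->
  nu.-integrable Rpos (EFin \o f).
Proof.
move=> nufin mf fc; apply: (@le_integrable _ _ _ nu _ _ _
    (fun s => (c%:E * (Num.min s 1)%:E)%E)) => //.
- by move=> s Ps; rewrite /= lee_fin (le_trans (fc _ Ps))// ler_norm.
- by apply: integrableZl => //; exact: integrable_min_one.
Qed.

Lemma integrable_one_sub_expR nu l : (truncated_mass nu < +oo)%E -> 0 < l ->
  nu.-integrable Rpos (fun s => (1 - expR (- (l * s)))%:E).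
Proof.
move=> nufin l0; apply: (integrable_dominated_min_one (c := Num.max 1 l)) => //.
  exact: measurable_one_sub_expR.
by move=> s Ps; rewrite ger0_norm ?one_sub_expR_ge0// one_sub_expR_le.
Qed.

Lemma integrable_mul_expR nu l : (truncated_mass nu < +oo)%E -> 0 < l ->
  nu.-integrable Rpos (fun s => (s * expR (- (l * s)))%:E).
Proof.
move=> nufin l0; apply: (integrable_dominated_min_one (c := Num.max 1 l^-1)) => //.
  exact: measurable_mul_expR.
by move=> s Ps; rewrite ger0_norm ?mul_expR_ge0// mul_expR_le.
Qed.

Lemma is_derive_one_sub_expR s l :
  is_derive l 1 (fun x : R => 1 - expR (- (x * s))) (s * expR (- (l * s))).
Proof.
have h : is_derive l 1 (fun x : R => - (x * s)) (- s).
  by apply: is_derive_eq; rewrite /GRing.scale/= !(mulr0,mulr1,add0r).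
have := @is_derive1_comp R expR (fun x : R => - (x * s)) l _ _ _ h => h2.
apply: is_derive_eq.
by ring.
Qed.

(** Differentiation under the integral sign on the neighbourhood []l / 2, 2 l[], which stays away
    from 0 so that one dominating function serves throughout. *)
Lemma is_derive_levy_khintchine (a b : R) nu l :
  (truncated_mass nu < +oo)%E -> 0 < l ->
  is_derive l 1 (levy_khintchine a b nu)
    (b + \int[nu]_(s in Rpos) (s * expR (- (l * s)))).
Proof.
move=> nufin l0.
have Il : (`]l / 2, 2 * l[%classic : set R) l by rewrite /= in_itv/=; apply/andP; lra.
have posI x : (`]l / 2, 2 * l[%classic : set R) x -> 0 < x.
  by rewrite /= in_itv/= => /andP[+ _]; lra.
pose f (x s : R) := 1 - expR (- (x * s)).
have intf x : (`]l / 2, 2 * l[%classic : set R) x ->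
    nu.-integrable Rpos (EFin \o f x).
  by move=> /posI x0; exact: integrable_one_sub_expR.
have derf (x s : R) : (`]l / 2, 2 * l[%classic : set R) x -> Rpos s ->
    derivable (f ^~ s) x 1.
  by move=> _ _; have [] := is_derive_one_sub_expR s x.
have d1f x s : partial1of2 f x s = s * expR (- (x * s)).
  rewrite partial1of2E; have h := is_derive_one_sub_expR s x; exact: derive_val.
(* The derivative [s e^(-x s)] decreases in [x], so its bound at the left end [l / 2] holds on the
   whole interval. The norm in [G] makes it non-negative for every real [s]. *)
pose c := Num.max 1 (l / 2)^-1.
pose G (s : R) := `|c * Num.min s 1|.
have intG : nu.-integrable Rpos (EFin \o G).
  apply: (integrable_dominated_min_one (c := c)) => //.
    apply/measurable_EFinP; apply: measurableT_comp => //.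
    by apply: measurable_funM => //; exact: measurable_minr.
  move=> s; rewrite /= in_itv/= andbT => s0.
  by rewrite normr_id ger0_norm// mulr_ge0// ?le_max ?ler01// le_min ler01 ltW.
have Gub x s : (`]l / 2, 2 * l[%classic : set R) x -> Rpos s ->
    `|partial1of2 f x s| <= G s.
  move=> Ix Ps; rewrite d1f ger0_norm ?mul_expR_ge0// (le_trans _ (ler_norm _))//.
  apply: le_trans (mul_expR_le _ Ps); last by lra.
  move: (Ps) Ix; rewrite /= !in_itv/= andbT => s0 /andP[lx _].
  by rewrite ler_wpM2l ?(ltW s0)// ler_expR lerN2 ler_wpM2r ?(ltW lx) ?(ltW s0).
have dI := @derivable_under_integral _ _ _ nu f _ measurable_Rpos _ _ _ Il intf
  derf G (fun=> normr_ge0 _) intG Gub.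
have dE := @differentiation_under_integral _ _ _ nu f _ measurable_Rpos _ _ _ Il intf
  derf G (fun=> normr_ge0 _) intG Gub.
have h : is_derive l 1 (fun x => \int[nu]_(s in Rpos) (1 - expR (- (x * s))))
    (\int[nu]_(s in Rpos) (s * expR (- (l * s)))).
  apply: DeriveDef; first exact: dI.
  by rewrite -derive1E dE; apply: eq_Rintegral => s _; rewrite /= d1f.
rewrite /levy_khintchine; apply: is_derive_eq.
by rewrite /GRing.scale/=; ring.
Qed.

End levy_khintchine_theory.

(** * Sums over a Poisson point process *)

Section poisson_laplace.
Context {R : realType}.
Local Open Scope ereal_scope.

Lemma nneseries_pick (a : nat -> \bar R) k0 : 0 <= a k0 ->
  \sum_(k <oo) (if k == k0 then a k else 0) = a k0.
Proof.
move=> a0; rewrite nneseries_esumT; last by move=> k; case: eqP => // ->.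
rewrite -(esum_set1 a0) [RHS]esum_mkcond; apply: eq_esum => k _.
have [->|kk0] := eqVneq k k0; first by rewrite mem_set.
by rewrite memNset// => /eqP; rewrite (negbTE kk0).
Qed.

(** For [r > 0] the sum is [e^(-r)] times the exponential series at [r e^(-c)]. The rate 0 is
    separate: there [poisson_prob] is the Dirac mass at 0 and only [k = 0] contributes. *)
Lemma poisson_prob_laplace (r c : R) : (0 <= r)%R ->
  \sum_(k <oo) ((expR (- (c * k%:R)))%:E * poisson_prob r 0%N [set k]) =
  (expR (- (r * (1 - expR (- c)))))%:E.
Proof.
rewrite le_eqVlt => /predU1P[<-|r0].
  rewrite mul0r oppr0 expR0.
  rewrite -[RHS](@nneseries_pick (fun=> 1) 0%N) ?lee_fin//.
  apply: eq_eseriesr => k _.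
  rewrite /poisson_prob ltxx diracE; have [->|k0] := eqVneq k 0%N.
    by rewrite mem_set// mulr0 oppr0 expR0 mule1.
  by rewrite memNset ?mule0//=; apply/eqP; rewrite eq_sym.
under eq_eseriesr => k _.
  rewrite /poisson_prob r0 esum_set1 ?lee_fin ?poisson_pmf_ge0//.
  rewrite /poisson_pmf r0 (_ : _ * _ = (expR (- r))%:E *
    ((r * expR (- c)) ^+ k / k`!%:R)%:E); last first.
    by rewrite -!EFinM; congr EFin; rewrite -mulNr expRM_natr exprMn; ring.
  over.
rewrite /= nneseriesZl/=; last first.
  by move=> n _; rewrite lee_fin divr_ge0// exprn_ge0// mulr_ge0 ?expR_ge0// ltW.
have -> : (expR (- (r * (1 - expR (- c)))) = expR (- r) * expR (r * expR (- c)))%R.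
  by rewrite -expRD; congr expR; ring.
rewrite EFinM; congr *%E; move: (r * expR (- c))%R => x.
rewrite expRE -EFin_lim; last first.
  rewrite /pseries/=; under eq_fun do rewrite mulrC.
  exact: is_cvg_series_exp_coeff.
apply/congr_lim/funext => n/=; rewrite /pseries/= /series/= -sumEFin//.
by under eq_bigr do rewrite mulrC.
Qed.

End poisson_laplace.

Section independent_poisson_counts.
Context {R : realType} d (T : measurableType d) (P : probability T R).
Local Open Scope ereal_scope.
Variables (m : nat) (N : 'I_m -> T -> \bar R) (r c : 'I_m -> R).
Hypothesis mN : forall i, measurable_fun setT (N i).
Hypothesis Nnat : forall i w, N i w = +oo \/ exists k, N i w = k%:R%:E.
Hypothesis r0 : forall i, (0 <= r i)%R.
Hypothesis c0 : forall i, (0 < c i)%R.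
Hypothesis jointN : forall k : 'I_m -> nat,
  P (\bigcap_(i in [set: 'I_m]) [set w | N i w = (k i)%:R%:E]) =
  \prod_(i < m) poisson_prob (r i) 0%N [set k i].

Let Phi i w : R := fine (expeR (- ((c i)%:E * N i w))).
Let level i (k : nat) : set T := [set w | N i w = k%:R%:E].
Let pois i k : R := fine (poisson_prob (r i) 0%N [set k]).
Let V i : R := expR (- (r i * (1 - expR (- c i)))).

Let mlevel i k : measurable (level i k).
Proof.
rewrite (_ : level i k = setT `&` N i @^-1` [set k%:R%:E]); last by rewrite setTI.
by apply: mN => //; exact: emeasurable_set1.
Qed.

Let poisE i k : (pois i k)%:E = poisson_prob (r i) 0%N [set k].
Proof.
rewrite fineK// ge0_fin_numE//.
by rewrite (le_lt_trans (@probability_le1 _ _ _ _ [set k] _))// ltry.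
Qed.

(** At most one indicator is nonzero; where the count is infinite none is, in agreement with
    [expeR -oo = 0] as [c i > 0]. *)
Let PhiE i w : (Phi i w)%:E =
  \sum_(k <oo) (expR (- (c i * k%:R)) * \1_(level i k) w)%:E.
Proof.
rewrite /Phi; have [Noo|[k0 Nk0]] := Nnat i w.
  rewrite Noo gt0_muley ?lte_fin//= eseries0// => k _ _.
  by rewrite indicE memNset ?mulr0// /level/= Noo.
rewrite -[RHS](eq_eseriesr
  (f := fun k => if k == k0 then (expR (- (c i * k%:R)))%:E else 0)).
  by rewrite nneseries_pick ?lee_fin ?expR_ge0// Nk0.
move=> k _; rewrite indicE; have [->|kk0] := eqVneq k k0.
  by rewrite mem_set ?mulr1.
rewrite memNset ?mulr0// /level/= Nk0 => -[/eqP]; rewrite eqr_nat.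
by rewrite eq_sym (negbTE kk0).
Qed.

(* The first j indicators of levels are replaced by their exponential sums; the
   joint law gives the integral for j = 0, and each step sums over one level. *)
Let mixed j (kap : 'I_m -> nat) w : R :=
  (\prod_(i < m) (if (i < j)%N then Phi i w else \1_(level i (kap i)) w))%R.

Let mPhi i : measurable_fun setT (Phi i).
Proof.
apply/measurable_EFinP; rewrite (_ : _ \o _ = fun w =>
  \sum_(k <oo) (expR (- (c i * k%:R)) * \1_(level i k) w)%:E); last first.
  by apply/funext => w /=; rewrite PhiE.
apply: ge0_emeasurable_sum.
  by move=> k w _ _; rewrite lee_fin mulr_ge0 ?expR_ge0.
move=> k _; apply/measurable_EFinP; apply: measurable_funM => //.
Qed.

Let mmixed j kap : measurable_fun setT (mixed j kap).
Proof.
rewrite /mixed; apply: measurable_prod => i _.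
by case: (i < j)%N; [exact: mPhi|exact: measurable_indic].
Qed.

Let mixed_ge0 j kap w : (0 <= mixed j kap w)%R.
Proof.
apply: prodr_ge0 => i _; case: ifPn => // _.
by rewrite fine_ge0// expeR_ge0.
Qed.

Let integral_mixed j : (j <= m)%N -> forall kap,
  \int[P]_w (mixed j kap w)%:E =
  (\prod_(i < m) (if (i < j)%N then V i else pois i (kap i)))%R%:E.
Proof.
elim: j => [_ kap|j IH jm kap].
  rewrite (eq_bigr (fun i => pois i (kap i)))//.
  rewrite -prodEFin; rewrite (eq_bigr _ (fun i _ => poisE i (kap i))).
  rewrite -jointN -[X in P X]setIT -integral_indic//; last first.
    apply: fin_bigcap_measurable => //.
    by move=> i _; exact: mlevel.
  apply: eq_integral => w _; rewrite /mixed.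
  rewrite (eq_bigr (fun i => \1_(level i (kap i)) w))//; congr EFin.
  rewrite [RHS]indicE; case: (boolP (w \in _)) => [|].
    by rewrite inE => h; apply: big1 => i _; rewrite indicE mem_set//; exact: h.
  rewrite notin_setE => h; have /existsNP[i hi] : ~ forall i, level i (kap i) w.
    by move=> h'; apply: h => i _; exact: h'.
  by rewrite (bigD1 i)//= indicE memNset// mul0r.
pose i0 := Ordinal jm.
pose upd k i := if i == i0 then k else kap i.
have split_prod (F G : 'I_m -> R) x : (F i0 = x)%R ->
    (forall i, i != i0 -> F i = G i) ->
    (\prod_(i < m) F i = x * \prod_(i < m | i != i0) G i)%R.
  by move=> <- FG; rewrite (bigD1 i0)//=; congr (_ * _)%R; exact: eq_bigr.
have ltS (i : 'I_m) : i != i0 -> (i < j.+1)%N = (i < j)%N.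
  by move=> ii0; rewrite ltnS leq_eqVlt (_ : (i == j :> nat) = false)//; apply/negbTE.
(* The factor [i0] is expanded over its levels; [upd k] records the level [k] in that coordinate, so
   the induction hypothesis applies to each term. *)
transitivity (\int[P]_w
    \sum_(k <oo) ((expR (- (c i0 * k%:R)))%:E * (mixed j (upd k) w)%:E)).
  apply: eq_integral => w _.
  pose G (i : 'I_m) := (if (i < j)%N then Phi i w else \1_(level i (kap i)) w)%R.
  rewrite /mixed (split_prod _ G (Phi i0 w)); first last.
  - by move=> i ii0; rewrite /G ltS.
  - by rewrite /= ltnSn.
  rewrite mulrC EFinM PhiE -nneseriesZl; last first.
    by move=> k _; rewrite lee_fin mulr_ge0 ?expR_ge0.
  apply: eq_eseriesr => k _; rewrite -!EFinM; congr EFin.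
  rewrite (split_prod _ G (\1_(level i0 k) w)); first last.
  - by move=> i ii0; rewrite /G /upd (negbTE ii0).
  - by rewrite /= ltnn /upd eqxx.
  by ring.
rewrite integral_nneseries//; last 2 first.
- move=> k; apply: measurable_funeM; apply/measurable_EFinP; exact: mmixed.
- by move=> k w _; rewrite -EFinM lee_fin mulr_ge0 ?expR_ge0.
pose G (i : 'I_m) := (if (i < j)%N then V i else pois i (kap i))%R.
have stepE k : \int[P]_w ((expR (- (c i0 * k%:R)))%:E * (mixed j (upd k) w)%:E) =
    (\prod_(i < m | i != i0) G i)%R%:E *
    ((expR (- (c i0 * k%:R)))%:E * poisson_prob (r i0) 0%N [set k]).
  rewrite ge0_integralZl//; last 2 first.
  - by apply/measurable_EFinP; exact: mmixed.
  - by move=> w _; rewrite lee_fin.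
  rewrite IH ?(ltnW jm)// (split_prod _ G (pois i0 k)); first last.
  - by move=> i ii0; rewrite /G /upd (negbTE ii0).
  - by rewrite /= ltnn /upd eqxx.
  by rewrite -poisE -!EFinM; congr EFin; ring.
rewrite (eq_eseriesr (fun k _ => stepE k)) nneseriesZl; last first.
  by move=> k _; rewrite mule_ge0// lee_fin expR_ge0.
rewrite (poisson_prob_laplace _ (r0 i0)) (split_prod _ G (V i0)); first last.
- by move=> i ii0; rewrite /G ltS.
- by rewrite /= ltnSn.
by rewrite -EFinM mulrC.
Qed.

(** The case [j = m] of [integral_mixed], where every indicator has been replaced and the choice of
    levels has disappeared. *)
Lemma laplace_poisson_counts :
  \int[P]_w (\prod_(i < m) expeR (- ((c i)%:E * N i w))) =
  (expR (- \sum_(i < m) r i * (1 - expR (- c i))))%:E.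
Proof.
transitivity (\int[P]_w (mixed m (fun=> 0%N) w)%:E).
  apply: eq_integral => w _; rewrite /mixed -prodEFin; apply: eq_bigr => i _.
  rewrite ltn_ord fineK//.
  have [->|[k ->]] := Nnat i w; last by [].
  by rewrite gt0_muley ?lte_fin.
rewrite integral_mixed//; congr EFin; rewrite -sumrN expR_sum.
by apply: eq_bigr => i _; rewrite ltn_ord.
Qed.

End independent_poisson_counts.

(** * Sums over arbitrary index sets *)

Section esum_counting.
Context {R : realType}.
Local Open Scope ereal_scope.

Lemma esum1_counting (I : choiceType) (A : set I) :
  \esum_(i in A) 1 = counting A :> \bar R.
Proof.
rewrite /counting; case: ifPn => /asboolP finA.
  rewrite esum_fset// fsbig_finite//= sumEFin; congr EFin.
  by rewrite -[X in (\sum_(i <- _) X)%R]/(1%:R)%R -natr_sum sum1_size.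
apply/eq_infty => y.
have [B BA yB] := infinite_set_fset (Num.truncn y).+1 finA.
apply: esum_ge; eexists; first by split; last exact: BA.
rewrite fsbig_finite//= set_fsetK sumEFin lee_fin.
rewrite -[X in (\sum_(i <- _) X)%R]/(1%:R)%R -natr_sum sum1_size.
by rewrite (le_trans (ltW (truncnS_gt y)))// ler_nat.
Qed.

Lemma ge0_esumZl (I : choiceType) (A : set I) (a : I -> \bar R) (r : R) :
  (0 <= r)%R -> (forall i, A i -> 0 <= a i) ->
  \esum_(i in A) (r%:E * a i) = r%:E * \esum_(i in A) a i.
Proof.
move=> r0 a0; rewrite /esum -ereal_supZl//; last first.
  by apply/set0P; exists 0, set0; [exact: fsets_set0|rewrite fsbig_set0].
congr ereal_sup; have rsum X : fsets A X ->
    \sum_(i \in X) (r%:E * a i) = r%:E * \sum_(i \in X) a i.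
  move=> [finX XA]; rewrite !fsbig_finite//= !big_seq ge0_sume_distrr// => i.
  by rewrite in_fset_set// => /set_mem/XA/a0.
apply/seteqP; split => x /=.
  by move=> [X AX <-]; exists (\sum_(i \in X) a i); [exists X|rewrite rsum].
by move=> [_ [X AX <-] <-]; exists X => //; rewrite rsum.
Qed.

Lemma esum_point_count d (T : measurableType d) (e : R -> T -> \bar R) (A : set R)
    (B : set (\bar R)) w :
  \esum_(s in A) (\1_B (e s w))%:E = point_count e A B w.
Proof.
rewrite /point_count -esum1_counting.
rewrite (_ : [set s | _] = A `&` [set s | B (e s w)])// esum_mkcondr.
apply: eq_esum => s _; rewrite indicE.
by have [h|h] := pselect (B (e s w)); [rewrite !mem_set|rewrite !memNset].
Qed.

(** Monotone convergence for sums over a possibly uncountable set, here a time interval: both sides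
    are suprema over finite subsets, and finite sums commute with the limit. *)
Lemma cvg_esum_nondecreasing (I : choiceType) (A : set I)
    (a_ : nat -> I -> \bar R) (a : I -> \bar R) :
  (forall n i, A i -> 0 <= a_ n i) ->
  (forall i, A i -> nondecreasing_seq (a_ ^~ i)) ->
  (forall i, A i -> a_ ^~ i @ \oo --> a i) ->
  \esum_(i in A) a_ n i @[n --> \oo] --> \esum_(i in A) a i.
Proof.
move=> a0 nd cva.
have le_a n i : A i -> a_ n i <= a i.
  move=> Ai; have -> : a i = ereal_sup (range (a_ ^~ i)).
    apply: (cvg_unique (@ereal_hausdorff R) (cva i Ai)).
    exact: ereal_nondecreasing_cvgn (nd i Ai).
  by apply: ereal_sup_ubound; exists n.
have nd_sum : nondecreasing_seq (fun n => \esum_(i in A) a_ n i).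
  by move=> n p np; apply: le_esum => i Ai; exact: nd.
rewrite (_ : \esum_(i in A) a i = ereal_sup (range (fun n => \esum_(i in A) a_ n i))).
  exact: ereal_nondecreasing_cvgn.
apply/eqP; rewrite eq_le; apply/andP; split; last first.
  by apply: ge_ereal_sup => _ [n _ <-]; apply: le_esum => i; exact: le_a.
apply: ge_ereal_sup => _ [X [finX XA] <-].
have cvX : \sum_(i \in X) a_ n i @[n --> \oo] --> \sum_(i \in X) a i.
  rewrite fsbig_finite//= (_ : (fun n => _) =
    fun n => \sum_(i <- finmap.enum_fset (fset_set X)) a_ n i).
    rewrite !big_seq; under eq_fun do rewrite big_seq.
    apply: cvg_nnesum => i; rewrite in_fset_set// => /set_mem/XA Ai.
      by apply: nearW => n; exact: a0.
    exact: cva.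
  by apply/funext => n; rewrite fsbig_finite.
rewrite -(cvg_lim _ cvX)//; apply: lime_le; first by apply/cvg_ex; eexists; exact: cvX.
apply: nearW => n; apply: le_trans (ereal_sup_ubound _); last by exists n.
by apply: ereal_sup_ubound; exists X.
Qed.

End esum_counting.

(** * The decreasing exponential on the extended half-line *)

Section expeR_opp.
Context {R : realType}.
Local Open Scope ereal_scope.

Lemma ge0_expeRND (x y : \bar R) : 0 <= x -> 0 <= y ->
  expeR (- (x + y)) = expeR (- x) * expeR (- y).
Proof.
by move: x y => [x| |] [y| |] //= x0 y0; rewrite ?mul0e ?mule0// opprD expRD EFinM.
Qed.

Lemma ge0_expeRN_sum (I : Type) (s : seq I) (F : I -> \bar R) :
  (forall i, 0 <= F i) ->
  expeR (- \sum_(i <- s) F i) = \prod_(i <- s) expeR (- F i).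
Proof.
move=> F0; elim: s => [|i s IH]; first by rewrite !big_nil oppe0 expeR0.
by rewrite !big_cons ge0_expeRND ?IH// sume_ge0.
Qed.

Lemma cvg_expeRN (u : nat -> \bar R) (l : \bar R) : 0 <= l ->
  u @ \oo --> l -> expeR (- u n) @[n --> \oo] --> expeR (- l).
Proof.
case: l => [l| |]// l0.
  move=> /fine_cvgP[ufin ul].
  apply: (@cvg_trans _ ((fun n => (expR (- fine (u n)))%:E) @ \oo)).
    apply: near_eq_cvg; near=> n.
    by have /fineK <- : u n \is a fin_num by near: n.
  apply: cvg_EFin; first exact: nearW.
  apply: (@cvg_comp _ _ _ _ expR _ (nbhs (- l)%R)); last exact: continuous_expR.
  exact: cvgN.
move=> /cvgeyPge uoo /=.
apply/fine_cvgP; split.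
  have [N _ HN] := uoo 0%R; exists N => // n /HN.
  by case: (u n).
apply/cvgr0Pnorm_le => eps eps0.
(* The threshold is the solution [x] of [e^(-x) = eps]. *)
have [N _ HN] := uoo (- ln eps)%R; exists N => // n /HN /=.
case: (u n) => [x| |]//=; last by rewrite normr0 => _; exact: ltW.
rewrite lee_fin => h; rewrite ger0_norm ?expR_ge0//.
by rewrite -[leRHS]lnK ?posrE// ler_expR lerNl.
Unshelve. all: end_near. Qed.

End expeR_opp.

Lemma measurable_expeR {R : realType} : measurable_fun setT (@expeR R).
Proof.
(* [er_map] fixes [-oo], whereas [expeR] sends it to 0; the maximum corrects this one value. *)
rewrite (_ : expeR = fun x => maxe (er_map expR x) 0)%E.
  apply: measurable_maxe; last exact: measurable_cst.
  exact: (@measurable_er_map _ R R expR (@measurable_expR R)).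
apply/funext => -[x| |] /=.
- by rewrite max_l// lee_fin expR_ge0.
- by rewrite max_l// leey.
- by rewrite max_r// leNye.
Qed.

Lemma expeRN_le1 {R : realType} (x : \bar R) : (0 <= x)%E -> (expeR (- x) <= 1)%E.
Proof. by move=> x0; rewrite -expeR0 lee_expeR oppe_le0. Qed.

(** * Laplace transform of the sum of a Poisson point process *)

Section campbell.
Import HBNNSimple.
Context {R : realType} d (T : measurableType d) (Q : probability T R).
Variables (e : R -> T -> \bar R) (phi : {measure set (\bar R) -> \bar R}).
Hypothesis he : poisson_point_process Q e phi.
Hypothesis phi_fin : forall r, (0 < r)%R -> (phi [set x | (r%:E <= x)%E] < +oo)%E.
Variables (t l : R).
Hypotheses (t0 : (0 <= t)%R) (l0 : (0 < l)%R).
Local Open Scope ereal_scope.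

Let pos : set (\bar R) := [set x | 0 < x].

Let mpos : measurable pos.
Proof.
rewrite (_ : pos = setT `&` [set x | 0 < x]); last by rewrite setTI.
exact: emeasurable_fun_o_infty.
Qed.

Section step.
Variable g : {nnsfun \bar R >-> R}.
Hypothesis g_le : forall x, 0 <= x -> (g x)%:E <= x.

(** Only the positive values of [g] are listed: the value 0 adds nothing to the sum, and its level
    set may have infinite [phi]-mass. *)
Let s := [seq r <- finmap.enum_fset (fset_set (range g)) | (0 < r)%R].
Let m := size s.
Let r (i : 'I_m) : R := nth 0%R s i.
Let B (i : 'I_m) : set (\bar R) := g @^-1` [set r i] `&` pos.

Let us : uniq s. Proof. by rewrite filter_uniq// finmap.fset_uniq. Qed.

Let mem_s y : (y \in s) = (0 < y)%R && (y \in range g).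
Proof. by rewrite mem_filter in_fset_set. Qed.

Let r_gt0 i : (0 < r i)%R.
Proof. by have := mem_nth 0%R (ltn_ord i); rewrite -/s mem_s => /andP[]. Qed.

Let mB i : measurable (B i).
Proof. by apply: measurableI => //; exact: measurable_funPTI. Qed.

(** Serves twice: with the identity for the sum of the jumps, and with [1 - e^(-l y)] for the
    exponent. By [g_le] a positive value of [g] forces [x > 0], so intersecting with [pos] loses
    nothing. *)
Let stepE (h : R -> R) x : h 0%R = 0%R -> 0 <= x ->
  (h (g x) = \sum_(i < m) h (r i) * \1_(B i) x)%R.
Proof.
move=> h0 x0.
rewrite (_ : \sum_(i < m) _ =
    \sum_(y <- s) h y * \1_(g @^-1` [set y] `&` pos) x)%R; last first.
  by rewrite (big_nth 0%R) big_mkord.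
have g0 : (0 <= g x)%R by [].
move: g0; rewrite le_eqVlt => /predU1P[gx0|gx0].
  rewrite -gx0 h0 big_seq big1// => y; rewrite mem_s => /andP[y0 _].
  rewrite indicE memNset ?mulr0//= => -[gxy _].
  by move: y0; rewrite -gxy -gx0 ltxx.
have gs : g x \in s by rewrite mem_s gx0; apply/mem_set; exists x.
rewrite (bigD1_seq (g x))//= indicE mem_set/= ?mulr1; last first.
  by split => //; rewrite /pos/= (lt_le_trans _ (g_le x0))// lte_fin.
rewrite big1 ?addr0// => y ygx; rewrite indicE memNset ?mulr0//= => -[gxy _].
by move: ygx; rewrite -gxy eqxx.
Qed.

(** As [g] lies below the identity, the level set of [r i] is contained in the ray from [r i], whose
    mass is finite. *)
Let phiB_fin i : phi (B i) < +oo.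
Proof.
apply: le_lt_trans (phi_fin (r_gt0 i)); apply: le_measure; rewrite ?inE//.
  rewrite (_ : [set _ | _] = setT `&` [set x | (r i)%:E <= x]); last by rewrite setTI.
  exact: emeasurable_fun_c_infty.
by move=> x [/= <- x0]; apply: g_le; exact: ltW.
Qed.

Let A (i : 'I_m) : set R := `[0%R, t].
Let N (i : 'I_m) : T -> \bar R := point_count e (A i) (B i).

Let lebA i : lebesgue_measure (A i) = t%:E.
Proof.
rewrite /A lebesgue_measure_itv/= lte_fin.
by move: t0; rewrite le_eqVlt => /predU1P[<-|->]; rewrite ?ltxx// sube0.
Qed.

Let poisson_counts : (forall i, measurable_fun setT (N i)) /\
  forall k : 'I_m -> nat,
    Q (\bigcap_(i in [set: 'I_m]) [set w | N i w = (k i)%:R%:E]) =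
    \prod_(i < m) poisson_prob (t * fine (phi (B i))) 0%N [set k i].
Proof.
have [_ /(_ m A B)[]] := he.
- move=> i; split; first exact: measurable_itv.
    by move=> u; rewrite /A/= !in_itv/= andbT => /andP[].
  by rewrite lebA ltry.
- by move=> i; split; [exact: mB|move=> x []|exact: phiB_fin].
(* All rectangles share the time interval; they are disjoint because the values listed in [s] are
   distinct. *)
- apply/trivIsetP => i j _ _ ij; apply/seteqP; split => // -[u x].
  move=> [[_ [/= gi _]] [_ [/= gj _]]].
  move: ij => /eqP; apply; apply: val_inj; apply/eqP.
  rewrite -(nth_uniq 0%R (ltn_ord i) (ltn_ord j) us).
  by apply/eqP; rewrite -[LHS]gi -[RHS]gj.
- move=> mN joint; split => // k; rewrite joint; apply: eq_bigr => i _.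
  by rewrite lebA fineM// ge0_fin_numE.
Qed.

Let Nnat i w : N i w = +oo \/ exists k, N i w = k%:R%:E.
Proof.
rewrite /N /point_count /counting; case: ifPn => _; last by left.
by right; eexists.
Qed.

Let N_ge0 i w : 0 <= N i w.
Proof. by have [->|[k ->]] := Nnat i w; rewrite ?leey// lee_fin. Qed.

Let stepS w := \esum_(u in `[0%R, t]) (g (e u w))%:E.

Let stepSE w : stepS w = \sum_(i < m) (r i)%:E * N i w.
Proof.
rewrite /stepS; transitivity (\esum_(u in `[0%R, t])
    \sum_(i < m) (r i)%:E * (\1_(B i) (e u w))%:E).
  apply: eq_esum => u; rewrite /= in_itv/= => /andP[u0 _].
  rewrite (stepE (h := id))//; last exact: he.1.
  by rewrite -sumEFin.
rewrite esum_sum; last first.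
  by move=> u i _ _; rewrite -EFinM lee_fin mulr_ge0// ltW.
apply: eq_bigr => i _; rewrite ge0_esumZl//; last exact/ltW.
by rewrite esum_point_count.
Qed.

Lemma measurable_step_sum : measurable_fun setT stepS.
Proof.
rewrite (_ : stepS = fun w => \sum_(i < m) (r i)%:E * N i w); last first.
  by apply/funext => w; exact: stepSE.
by apply: emeasurable_sum => i; apply: measurable_funeM; exact: poisson_counts.1.
Qed.

(** The sum of the discretised jumps is the combination of the [N i] with coefficients [r i], and
    these counts are independent Poisson variables of parameters [t * phi (B i)]. *)
Lemma laplace_step_sum :
  \int[Q]_w expeR (- (l%:E * stepS w)) =
  expeR (- (t%:E * \int[phi]_(x in pos) (1 - expR (- (l * g x)))%:E)).
Proof.
transitivity (\int[Q]_w \prod_(i < m) expeR (- ((l * r i)%:E * N i w))).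
  apply: eq_integral => w _; rewrite stepSE ge0_sume_distrr; last first.
    by move=> i _; rewrite mule_ge0 ?lee_fin ?(ltW (r_gt0 i)).
  rewrite ge0_expeRN_sum; last first.
    by move=> i; rewrite !mule_ge0 ?lee_fin ?(ltW (r_gt0 i)) ?(ltW l0).
  by apply: eq_bigr => i _; rewrite EFinM muleA.
rewrite (@laplace_poisson_counts _ _ _ Q m N (fun i => t * fine (phi (B i)))%R
    (fun i => l * r i)%R)//; last 4 first.
- exact: poisson_counts.1.
- by move=> i; rewrite mulr_ge0// fine_ge0.
- by move=> i; rewrite mulr_gt0.
- exact: poisson_counts.2.
rewrite (_ : \int[phi]_(x in pos) _ =
    (\sum_(i < m) fine (phi (B i)) * (1 - expR (- (l * r i))))%R%:E).
  rewrite -EFinM -EFinN/=; congr (expR (- _))%:E; rewrite mulr_sumr.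
  by apply: eq_bigr => i _; rewrite mulrA.
transitivity (\int[phi]_(x in pos) \sum_(i < m)
    (1 - expR (- (l * r i)))%:E * (\1_(B i) x)%:E).
  apply: eq_integral => x; rewrite inE => x0.
  rewrite (stepE (h := fun y => 1 - expR (- (l * y)))%R) ?(ltW x0)//; last first.
    by rewrite mulr0 oppr0 expR0 subrr.
  by rewrite -sumEFin.
have c0 i : (0 <= 1 - expR (- (l * r i)))%R.
  by rewrite subr_ge0 expR_le1 oppr_le0 mulr_ge0// ltW.
rewrite ge0_integral_sum//; last 2 first.
- move=> i; apply: measurable_funeM; apply/measurable_EFinP.
  exact: measurable_indic.
- by move=> i x _; rewrite -EFinM lee_fin mulr_ge0.
rewrite -sumEFin; apply: eq_bigr => i _.
rewrite ge0_integralZl_EFin//; last first.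
  by apply/measurable_EFinP; exact: measurable_indic.
rewrite integral_indic// setIidl; last by move=> x [].
by rewrite EFinM fineK ?ge0_fin_numE// muleC.
Qed.

End step.

Let nonneg : set (\bar R) := [set x | 0 <= x].

Let mnonneg : measurable nonneg.
Proof.
rewrite (_ : nonneg = setT `&` [set x | 0 <= x]); last by rewrite setTI.
exact: emeasurable_fun_c_infty.
Qed.

Let mid : measurable_fun nonneg (@id (\bar R)).
Proof. exact: measurable_id. Qed.

Let g_ := nnsfun_approx mnonneg mid.

Let g_le n x : 0 <= x -> (g_ n x)%:E <= x.
Proof. by move=> x0; rewrite /g_ nnsfun_approxE; exact: le_approx. Qed.

Let nd_g x : nondecreasing_seq (fun n => (g_ n x)%:E).
Proof. by move=> n p np; rewrite lee_fin; exact/lefP/nd_nnsfun_approx. Qed.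

Let cvg_g x : 0 <= x -> (g_ n x)%:E @[n --> \oo] --> x.
Proof. by move=> x0; exact: (@cvg_nnsfun_approx _ _ _ _ mnonneg _ mid). Qed.

Let e_ge0 u w : `[0%R, t]%classic u -> 0 <= e u w.
Proof. by rewrite /= in_itv/= => /andP[u0 _]; exact: he.1. Qed.

Let cvg_S w : \esum_(u in `[0%R, t]) (g_ n (e u w))%:E @[n --> \oo] -->
  \esum_(u in `[0%R, t]) e u w.
Proof.
apply: cvg_esum_nondecreasing.
- by move=> n u _; rewrite lee_fin.
- by move=> u _; exact: nd_g.
- by move=> u ut; apply: cvg_g; exact: e_ge0.
Qed.

Lemma measurable_sum_poisson_point_process :
  measurable_fun setT (fun w => \esum_(u in `[0%R, t]) e u w).
Proof.
apply: (emeasurable_fun_cvg (fun n w => \esum_(u in `[0%R, t]) (g_ n (e u w))%:E)).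
  by move=> n; apply: measurable_step_sum; exact: g_le.
by move=> w _; exact: cvg_S.
Qed.

(** Limit of [laplace_step_sum] along simple functions increasing to the identity: dominated
    convergence with bound 1 on the left, monotone convergence in the exponent on the right. *)
Lemma laplace_sum_poisson_point_process :
  \int[Q]_w expeR (- (l%:E * \esum_(u in `[0%R, t]) e u w)) =
  expeR (- (t%:E * \int[phi]_(x in pos) (1 - expeR (- (l%:E * x))))).
Proof.
have Sg_ge0 n w : 0 <= \esum_(u in `[0%R, t]) (g_ n (e u w))%:E.
  by apply: esum_ge0 => u _; rewrite lee_fin.
have cvg_lhs : \int[Q]_w expeR (- (l%:E * \esum_(u in `[0%R, t]) (g_ n (e u w))%:E))
    @[n --> \oo] --> \int[Q]_w expeR (- (l%:E * \esum_(u in `[0%R, t]) e u w)).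
  apply: (@dominated_cvg _ _ _ Q setT measurableT _ _ (fun=> 1)) => //.
  - move=> n; apply: (measurableT_comp (@measurable_expeR R)).
    apply: (measurableT_comp (@oppe_measurable R setT)).
    by apply: measurable_funeM; apply: measurable_step_sum; exact: g_le.
  - move=> w _; apply: cvg_expeRN.
      rewrite mule_ge0 ?lee_fin ?(ltW l0)//; apply: esum_ge0 => u; exact: e_ge0.
    by apply: cvgeZl => //; exact: cvg_S.
  - exact: finite_measure_integrable_cst.
  - move=> n w _; rewrite gee0_abs ?expeR_ge0// expeRN_le1//.
    by rewrite mule_ge0 ?lee_fin ?(ltW l0).
have gE n x : (1 - expR (- (l * g_ n x)))%:E = 1 - expeR (- (l%:E * (g_ n x)%:E)).
  by [].
have cvg_rhs : \int[phi]_(x in pos) (1 - expR (- (l * g_ n x)))%:E @[n --> \oo] -->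
    \int[phi]_(x in pos) (1 - expeR (- (l%:E * x))).
  have cvgx x : pos x -> (1 - expR (- (l * g_ n x)))%:E @[n --> \oo] -->
      1 - expeR (- (l%:E * x)).
    move=> /ltW x0; under eq_fun do rewrite gE.
    apply: cvgeB.
    - by rewrite fin_num_adde_defr.
    - exact: cvg_cst.
    - apply: cvg_expeRN; first by rewrite mule_ge0 ?lee_fin ?(ltW l0).
      by apply: cvgeZl => //; exact: cvg_g.
  rewrite (_ : \int[phi]_(x in pos) (1 - expeR (- (l%:E * x))) =
      \int[phi]_(x in pos) limn (fun n => (1 - expR (- (l * g_ n x)))%:E)).
    apply: cvg_monotone_convergence => //.
    - move=> n; apply/measurable_EFinP; apply: measurable_funTS.
      apply: measurable_funB => //.
      apply: (measurableT_comp (@measurable_expR R)).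
      by apply: measurableT_comp => //; exact: measurable_funM.
    - move=> n x _; rewrite lee_fin subr_ge0 expR_le1 oppr_le0.
      by rewrite mulr_ge0// ltW.
    - move=> x _ n p np; rewrite lee_fin lerD2l lerN2 ler_expR lerN2.
      by rewrite ler_pM2l// -lee_fin; exact: nd_g.
  by apply: eq_integral => x; rewrite inE => x0; apply/esym/cvg_lim => //; exact: cvgx.
have stepE n : \int[Q]_w expeR (- (l%:E * \esum_(u in `[0%R, t]) (g_ n (e u w))%:E)) =
    expeR (- (t%:E * \int[phi]_(x in pos) (1 - expR (- (l * g_ n x)))%:E)).
  exact: laplace_step_sum (@g_le n).
move: cvg_lhs; rewrite (funext stepE) => cvg_lhs.
apply: (cvg_unique (@ereal_hausdorff R) cvg_lhs).
apply: cvg_expeRN; last by apply: cvgeZl.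
rewrite mule_ge0 ?lee_fin//; apply: integral_ge0 => x /ltW x0.
rewrite sube_ge0 ?fin_numE ?orbT//; apply: expeRN_le1.
by rewrite mule_ge0 ?lee_fin ?(ltW l0).
Qed.

End campbell.

(** * The distributed order subordinator *)

Section finite_law_theory.
Context {R : realType} d (T : measurableType d) (P : probability T R).
Implicit Types (Z : T -> \bar R) (mu : {measure set R -> \bar R}).
Local Notation Rnneg := (`[0%R, +oo[%classic : set R).

Let mD Z : measurable_fun setT Z -> measurable (Z @^-1` (EFin @` Rnneg)).
Proof.
move=> mZ; rewrite -[X in measurable X]setTI; apply: mZ => //.
by apply: measurable_image_EFin; exact: measurable_itv.
Qed.

(** The law is the image under [fine] of [P] restricted to the event that [Z] is finite and
    non-negative; the integral formula is kept with it for the Laplace transform. *)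
Lemma finite_law_exists Z : measurable_fun setT Z ->
  exists mu, finite_law P Z mu /\ forall g : R -> \bar R,
    (forall x, 0 <= g x)%E -> measurable_fun setT g ->
    (\int[mu]_x g x = \int[P]_(w in Z @^-1` (EFin @` Rnneg)) g (fine (Z w)))%E.
Proof.
move=> mZ; have mDZ := mD mZ.
have mf : measurable_fun (Z @^-1` (EFin @` Rnneg)) (fine \o Z).
  apply: measurable_funTS; apply: measurableT_comp => //; exact: fine_measurable.
have [//||mu muE] := transport_measure (w := fun=> 1) P mDZ _ _ mf.
  exact: measurable_cst.
have muE1 (g : R -> \bar R) : (forall x, 0 <= g x)%E -> measurable_fun setT g ->
    (\int[mu]_x g x = \int[P]_(w in Z @^-1` (EFin @` Rnneg)) g (fine (Z w)))%E.
  by move=> g0 mg; rewrite muE//; apply: eq_integral => w _; rewrite mul1e.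
exists mu; split => //; split => // B mB.
rewrite -[B in LHS]setIT -integral_indic// muE1; last 2 first.
- by move=> x; rewrite lee_fin.
- by apply/measurable_EFinP; exact: measurable_indic.
rewrite (eq_integral (fun w => (\1_(Z @^-1` (EFin @` B)) w)%:E)); last first.
  move=> w; rewrite inE/= => -[x x0 xZ]; rewrite -xZ/=; congr EFin.
  rewrite !indicE; congr ((nat_of_bool _)%:R); apply/idP/idP; rewrite !inE /= -xZ.
    by move=> Bx; exists x.
  by move=> -[x' Bx' [<-]].
rewrite integral_indic//; last first.
  by rewrite -[X in measurable X]setTI; apply: mZ => //; exact: measurable_image_EFin.
congr (P _); apply/seteqP; split => w /=.
  move=> [[x Bx xZ] [x' x'0 x'Z]]; exists x => //; split => //.
  by move: x'Z; rewrite -xZ => -[<-].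
by move=> [x [Bx x0] xZ]; split; exists x.
Qed.

(** A [finite_law] is determined on Borel sets, so [mu] may be replaced by the image measure. The
    mass lost at [+oo] does not matter, since [expeR -oo = 0] there. *)
Lemma finite_law_laplace Z mu (l : R) : finite_law P Z mu ->
  (forall w, 0 <= Z w)%E -> 0 < l ->
  (\int[mu]_(x in Rnneg) (expR (- (l * x)))%:E = \int[P]_w expeR (- (l%:E * Z w)))%E.
Proof.
move=> [mZ muE] Z0 l0; have [nu [[_ nuE] nuI]] := finite_law_exists mZ.
have mR : measurable Rnneg by exact: measurable_itv.
rewrite (eq_measure_integral nu); last first.
  by move=> A mA _; rewrite muE// nuE.
rewrite integral_mkcond nuI; last 2 first.
- by move=> x; rewrite patchE; case: ifPn => // _; rewrite lee_fin expR_ge0.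
- apply: (measurable_restrictT _ mR).1; apply/measurable_EFinP.
  exact: measurable_expRNM.
rewrite integral_mkcond; apply: eq_integral => w _; rewrite patchE.
case: ifPn => [|].
  by rewrite inE/= => -[x x0 <-]; rewrite patchE mem_set.
rewrite notin_setE/= => Zw; have := Z0 w; move: Zw.
case: (Z w) => [x| |]// Zw x0; last by rewrite gt0_muley ?lte_fin.
by exfalso; apply: Zw; exists x => //; rewrite /= in_itv/= andbT -lee_fin.
Qed.

Lemma finite_law_neg Z mu : finite_law P Z mu -> mu `]-oo, 0%R[%classic = 0%E.
Proof.
move=> [_ muE]; rewrite muE; last exact: measurable_itv.
rewrite (_ : _ @^-1` _ = set0) ?measure0//; apply/seteqP; split => // w /= [x [+ +] _].
by rewrite /= !in_itv/= andbT => xlt0 xge0; move: (lt_le_trans xlt0 xge0); rewrite ltxx.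
Qed.

End finite_law_theory.

(** * The mixed Lévy measure and the mixed jump measure *)

Section mixed_characteristic.
Context {R : realType} d (Y : measurableType d) (p : probability Y R).
Variables (W : set Y) (mW : measurable W).
Variables (a : Y -> R) (nu : Y -> {measure set R -> \bar R}).
Hypothesis mnu : forall U, measurable U -> measurable_fun setT (nu ^~ U).
Hypotheses (a0 : forall y, 0 <= a y) (ma : measurable_fun setT a).
Hypothesis afin : (\int[p]_(y in W) (a y)%:E < +oo)%E.
Hypothesis Vfin : (\int[p]_(y in W) truncated_mass (nu y) < +oo)%E.
Local Open Scope ereal_scope.
Local Notation Rpos := (`]0%R, +oo[%classic : set R).
Let mRpos : measurable Rpos := measurable_Rpos.
Let pos : set (\bar R) := [set x | 0 < x].

Let mpos : measurable pos.
Proof.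
rewrite (_ : pos = setT `&` [set x | 0 < x]); last by rewrite setTI.
exact: emeasurable_fun_o_infty.
Qed.

Definition mixed_levy_measure : {measure set R -> \bar R} :=
  mixture_measure p mW (fun U mU => measurable_funTS (mnu mU)).

Lemma integral_mixed_levy_measure (g : R -> \bar R) :
  (forall s, Rpos s -> 0 <= g s) -> measurable_fun Rpos g ->
  measurable_fun setT (fun y => \int[nu y]_(s in Rpos) g s) /\
  \int[mixed_levy_measure]_(s in Rpos) g s =
  \int[p]_(y in W) \int[nu y]_(s in Rpos) g s.
Proof.
move=> g0 mg.
have g0' s : 0 <= (g \_ Rpos) s by apply: erestrict_ge0.
have mg' : measurable_fun setT (g \_ Rpos) by apply: (measurable_restrictT _ mRpos).1.
split.
  rewrite (_ : (fun y => _) = fun y => \int[nu y]_s (g \_ Rpos) s); last first.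
    by apply/funext => y; rewrite integral_mkcond.
  exact: (measurable_fun_integral_mixture mnu g0' mg').
rewrite integral_mkcond (ge0_integral_mixture p mW
  (fun U mU => measurable_funTS (mnu mU)) g0' mg').
by apply: eq_integral => y _; rewrite [RHS]integral_mkcond.
Qed.

Let min0 s : Rpos s -> (0 <= Num.min s 1)%R.
Proof. by rewrite /= in_itv/= andbT => s0; rewrite le_min ler01 ltW. Qed.

Let mmin : measurable_fun Rpos (fun s : R => (Num.min s 1)%:E).
Proof. by apply/measurable_EFinP; exact: measurable_minr. Qed.

Lemma truncated_mass_mixed_levy_measure :
  truncated_mass mixed_levy_measure < +oo.
Proof.
have [|_ E] := @integral_mixed_levy_measure (fun s => (Num.min s 1)%:E) _ mmin.
  by move=> s Ps; rewrite lee_fin min0.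
by rewrite /truncated_mass E.
Qed.

Let finite_jump (y : Y) : {measure set (\bar R) -> \bar R}.
Proof.
by unshelve refine (pushforward (mrestr (nu y) mRpos) (@EFin R) :
  {measure set (\bar R) -> \bar R}); exact: EFin_measurable.
Defined.

Let jump y : {measure set (\bar R) -> \bar R} :=
  measure_add (finite_jump y) (mscale (NngNum (a0 y)) \d_(+oo)).

Let jumpE y B : jump y B =
  nu y (EFin @^-1` B `&` Rpos) + (a y)%:E * \d_(+oo) B.
Proof. exact: (measure_addE (finite_jump y)). Qed.

Let mjump B : measurable B -> measurable_fun W (jump ^~ B).
Proof.
move=> mB; apply: measurable_funTS; under eq_fun do rewrite jumpE.
apply: emeasurable_funD.
  by apply: mnu; apply: measurableI => //; rewrite -[X in measurable X]setTI;
    apply: EFin_measurable.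
apply: emeasurable_funM; first exact/measurable_EFinP.
exact: measurable_cst.
Qed.

Definition jump_measure : {measure set (\bar R) -> \bar R} :=
  mixture_measure p mW mjump.

(** Identifies the characteristic measure, given as a set function, with a genuine measure, as the
    Laplace computation requires. *)
Lemma jump_measureE :
  mixed_characteristic_measure p W a nu = jump_measure :> (set (\bar R) -> \bar R).
Proof.
apply/funext => B; rewrite /mixed_characteristic_measure /jump_measure /= /mixture.
by apply: eq_integral => y _; rewrite jumpE.
Qed.

Lemma integral_jump_measure (g : \bar R -> \bar R) :
  (forall x, 0 < x -> 0 <= g x) -> measurable_fun pos g ->
  \int[jump_measure]_(x in pos) g x =
  \int[p]_(y in W) (\int[nu y]_(s in Rpos) g s%:E + (a y)%:E * g +oo).
Proof.
move=> g0 mg.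
have g0' x : 0 <= (g \_ pos) x by apply: erestrict_ge0.
have mg' : measurable_fun setT (g \_ pos) by apply: (measurable_restrictT _ mpos).1.
rewrite integral_mkcond (ge0_integral_mixture p mW mjump g0' mg').
apply: eq_integral => y _; rewrite -integral_mkcond.
rewrite ge0_integral_measure_add//; congr (_ + _).
  rewrite ge0_integral_pushforward//; last by move=> x; rewrite inE; exact: g0.
  have -> : EFin @^-1` pos = Rpos.
    by apply/seteqP; split => s; rewrite /pos/= in_itv/= andbT lte_fin.
  by apply: eq_measure_integral => A mA AP /=; rewrite /mrestr setIidl.
rewrite ge0_integral_mscale//= integral_dirac//= diracE mem_set ?mul1e//.
by rewrite /pos/= ltry.
Qed.

Lemma jump_measure_fin (r : R) : (0 < r)%R ->
  jump_measure [set x | r%:E <= x] < +oo.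
Proof.
move=> r0; have mr : measurable [set x : \bar R | r%:E <= x].
  rewrite (_ : [set _ | _] = setT `&` [set x | r%:E <= x]); last by rewrite setTI.
  exact: emeasurable_fun_c_infty.
(* With this [c] the indicator of [s >= r] is at most [c * min s 1], so the mass of the ray is at
   most [c V(y) + a(y)], the second term coming from the atom at [+oo]. *)
pose c : R := Num.max 1%R (r^-1)%R.
have c1 : (1 <= c)%R by rewrite le_max lexx.
have c0 : (0 <= c)%R by rewrite (le_trans _ c1).
have cr : (1 <= c * r)%R by rewrite -ler_pdivrMr// mul1r le_max lexx orbT.
have mV : measurable_fun setT (fun y => truncated_mass (nu y)).
  by apply: (integral_mixed_levy_measure _ mmin).1 => s Ps; rewrite lee_fin min0.
have V0 y : 0 <= truncated_mass (nu y).
  by apply: integral_ge0 => s Ps; rewrite lee_fin min0.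
apply: (@le_lt_trans _ _ (\int[p]_(y in W) (c%:E * truncated_mass (nu y) + (a y)%:E))).
  rewrite /jump_measure /= /mixture; apply: ge0_le_integral => //.
  - exact: mjump.
  - apply: emeasurable_funD; last by apply/measurable_EFinP; exact: measurable_funTS.
    by apply: measurable_funeM; exact: measurable_funTS.
  - move=> y _; rewrite jumpE diracE mem_set/= ?leey// mule1 leeD2r//.
    rewrite -integral_indic ?mRpos//; last first.
      by rewrite -[X in measurable X]setTI; apply: EFin_measurable.
    rewrite -ge0_integralZl_EFin//.
    apply: ge0_le_integral => //.
    + by apply/measurable_EFinP; apply: measurable_indic;
        rewrite -[X in measurable X]setTI; apply: EFin_measurable.
    + exact: measurable_funeM.
    + move=> s; rewrite /= in_itv/= andbT => s0.
      rewrite -EFinM lee_fin indicE.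
      have [rs|rs] := leP r s.
        by rewrite mem_set/= ?lee_fin//; have [s1|s1] := leP s 1%R; nra.
      rewrite memNset/=; last by apply/negP; rewrite lee_fin -ltNge.
      by rewrite mulr_ge0// le_min ler01 ltW.
have mcV : measurable_fun W (fun y => c%:E * truncated_mass (nu y)).
  by apply: measurable_funeM; exact: measurable_funTS.
have cV0 y : W y -> 0 <= c%:E * truncated_mass (nu y).
  by move=> _; rewrite mule_ge0 ?lee_fin.
have maW : measurable_fun W (fun y => (a y)%:E).
  by apply/measurable_EFinP; exact: measurable_funTS.
have a0W y : W y -> 0 <= (a y)%:E by rewrite lee_fin.
rewrite ge0_integralD// lte_add_pinfty// ge0_integralZl_EFin//; last first.
  exact: measurable_funTS.
by rewrite lte_mul_pinfty.
Qed.

End mixed_characteristic.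

Lemma eq_stieltjes {R : realType} (h1 h2 : R -> R) :
  (forall l, 0 < l -> h1 l = h2 l) -> stieltjes h1 -> stieltjes h2.
Proof.
move=> h12 [a [b [sigma [a0 b0 fin h1E]]]]; exists a, b, sigma; split => // l l0.
by rewrite -h12// h1E.
Qed.

Lemma eq_derive1_pos {R : realType} (g1 g2 : R -> R) (l : R) :
  (forall x, 0 < x -> g1 x = g2 x) -> 0 < l -> derive1 g1 l = derive1 g2 l.
Proof.
move=> g12 l0; rewrite !derive1E; apply: near_eq_derive.
by near=> x; apply: g12; near: x; exact: lt_nbhsr.
Unshelve. all: end_near. Qed.

(** * Laplace exponent of the distributed order subordinator at a fixed time *)

Section distributed_order_laplace.
Context {R : realType} d (Y : measurableType d) (p : probability Y R).
Variables (W : set Y) (mW : measurable W).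
Variables (a b : Y -> R) (nu : Y -> {measure set R -> \bar R}).
Hypothesis mnu : forall U, measurable U -> measurable_fun setT (nu ^~ U).
Hypotheses (a0 : forall y, 0 <= a y) (b0 : forall y, 0 <= b y).
Hypotheses (ma : measurable_fun setT a) (mb : measurable_fun setT b).
Hypothesis afin : (\int[p]_(y in W) (a y)%:E < +oo)%E.
Hypothesis bfin : (\int[p]_(y in W) (b y)%:E < +oo)%E.
Hypothesis Vfin : (\int[p]_(y in W) truncated_mass (nu y) < +oo)%E.
Hypothesis hV : forall y, (truncated_mass (nu y) < +oo)%E.
Variables (t : R) (t0 : 0 <= t).
Local Notation Rpos := (`]0%R, +oo[%classic : set R).

Let abar : R := fine (\int[p]_(y in W) (a y)%:E)%E.
Let bbar : R := fine (\int[p]_(y in W) (b y)%:E)%E.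
Let M := mixed_levy_measure p mW mnu.
Let Mt : {measure set R -> \bar R} := mscale (NngNum t0) M.

(** This is [t] times the mixed exponent; the time is absorbed into the triplet so that the result
    is again of Lévy-Khintchine form. *)
Definition mixed_exponent : R -> R := levy_khintchine (t * abar) (t * bbar) Mt.

Let abarE : (abar%:E = \int[p]_(y in W) (a y)%:E)%E.
Proof.
by rewrite fineK// ge0_fin_numE//; apply: integral_ge0 => y _; rewrite lee_fin.
Qed.

Let bbarE : (bbar%:E = \int[p]_(y in W) (b y)%:E)%E.
Proof.
by rewrite fineK// ge0_fin_numE//; apply: integral_ge0 => y _; rewrite lee_fin.
Qed.

Let abar0 : 0 <= abar.
Proof. by apply/fine_ge0/integral_ge0 => y _; rewrite lee_fin. Qed.

Let bbar0 : 0 <= bbar.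
Proof. by apply/fine_ge0/integral_ge0 => y _; rewrite lee_fin. Qed.

Let Mfin : (truncated_mass M < +oo)%E.
Proof. exact: truncated_mass_mixed_levy_measure. Qed.

Let mRpos : measurable Rpos := measurable_Rpos.

Let integral_Mt (g : R -> \bar R) :
  (forall s, Rpos s -> 0 <= g s)%E -> measurable_fun Rpos g ->
  (\int[Mt]_(s in Rpos) g s = t%:E * \int[M]_(s in Rpos) g s)%E.
Proof. by move=> g0 mg; rewrite ge0_integral_mscale. Qed.

Let Mtfin : (truncated_mass Mt < +oo)%E.
Proof.
rewrite /truncated_mass integral_Mt ?lte_mul_pinfty ?lee_fin//.
- by move=> s; rewrite /= in_itv/= andbT => s0; rewrite lee_fin le_min ler01 ltW.
- by apply/measurable_EFinP; exact: measurable_minr.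
Qed.

Lemma bernstein_mixed_exponent : bernstein mixed_exponent.
Proof. by exists (t * abar), (t * bbar), Mt; split => //; rewrite mulr_ge0. Qed.

(** The derivative of the mixed exponent is the mixture of the derivatives, to which
    [stieltjes_mixture] applies. The factor [t] stays in the hypothesis because a law at time [t]
    only gives information on [t f(., y)]. *)
Lemma stieltjes_mixed_exponent :
  (forall y, stieltjes (fun l =>
    t * (b y + \int[nu y]_(s in Rpos) (s * expR (- (l * s)))))) ->
  stieltjes (derive1 mixed_exponent).
Proof.
move=> sh; apply: (stieltjes_mixture mW sh (m := p)) => l l0.
  have [|mI _] := integral_mixed_levy_measure p mW mnu _ (@measurable_mul_expR R l Rpos).
    by move=> s Ps; rewrite lee_fin mul_expR_ge0.
  apply: measurable_funM => //; apply: measurable_funD => //.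
  by apply: (measurableT_comp (fine_measurable measurableT)).
have dg := is_derive_levy_khintchine (t * abar) (t * bbar) Mtfin l0.
rewrite derive1E [in RHS]derive_val EFinD fineK; last first.
  exact: integrable_fin_num (integrable_mul_expR Mtfin l0).
have f0 s : Rpos s -> (0 <= (s * expR (- (l * s)))%:E)%E.
  by move=> Ps; rewrite lee_fin mul_expR_ge0.
have mf := @measurable_mul_expR R l Rpos.
have [mI IE] := integral_mixed_levy_measure p mW mnu f0 mf.
rewrite integral_Mt// EFinM -ge0_muleDr ?lee_fin ?integral_ge0//.
rewrite bbarE IE -ge0_integralD//; first last.
- exact: measurable_funTS.
- by move=> y _; apply: integral_ge0.
- by apply/measurable_EFinP; exact: measurable_funTS.
- by move=> y _; rewrite lee_fin.
rewrite -ge0_integralZl_EFin//; first last.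
- apply: emeasurable_funD; last exact: measurable_funTS.
  by apply/measurable_EFinP; exact: measurable_funTS.
- by move=> y _; rewrite adde_ge0 ?lee_fin ?integral_ge0.
apply: eq_integral => y _; rewrite EFinM EFinD fineK//.
exact: integrable_fin_num (integrable_mul_expR (hV y) l0).
Qed.

Section law.
Context dQ (Theta : measurableType dQ) (Q : probability Theta R).
Variable e : R -> Theta -> \bar R.
Hypothesis he : poisson_point_process Q e (mixed_characteristic_measure p W a nu).
Local Open Scope ereal_scope.

Let phi := jump_measure p mW mnu a0 ma.

Let hphi : poisson_point_process Q e phi.
Proof. by rewrite -[phi : set _ -> _](jump_measureE p mW mnu a0 ma). Qed.

Let phi_fin := jump_measure_fin mW mnu a0 ma afin Vfin.

Let S := distributed_order_subordinator p W b e t.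

Lemma distributed_order_subordinator_ge0 w : 0 <= S w.
Proof.
rewrite /S /distributed_order_subordinator adde_ge0//.
  by rewrite -bbarE -EFinM lee_fin mulr_ge0.
by apply: esum_ge0 => s; rewrite /= in_itv/= => /andP[s0 _]; exact: he.1.
Qed.

Lemma measurable_distributed_order_subordinator : measurable_fun setT S.
Proof.
apply: emeasurable_funD => //.
exact: (measurable_sum_poisson_point_process hphi phi_fin t0).
Qed.

Lemma laplace_distributed_order_subordinator l : (0 < l)%R ->
  \int[Q]_w expeR (- (l%:E * S w)) = (expR (- mixed_exponent l))%:E.
Proof.
move=> l0.
have sum0 w : 0 <= \esum_(s in `[0%R, t]) e s w.
  by apply: esum_ge0 => s; rewrite /= in_itv/= => /andP[s0 _]; exact: he.1.
transitivity (\int[Q]_w ((expR (- (l * (t * bbar))))%:E *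
    expeR (- (l%:E * \esum_(s in `[0%R, t]) e s w)))).
  apply: eq_integral => w _.
  rewrite /S /distributed_order_subordinator -bbarE -EFinM.
  rewrite ge0_muleDr ?lee_fin ?mulr_ge0// ge0_expeRND//.
    by rewrite -EFinM lee_fin !mulr_ge0// ltW.
  by rewrite mule_ge0// lee_fin ltW.
rewrite ge0_integralZl_EFin ?expR_ge0//; first last.
- apply: (measurableT_comp (@measurable_expeR R)).
  apply: (measurableT_comp (@oppe_measurable R setT)).
  by apply: measurable_funeM; exact: (measurable_sum_poisson_point_process hphi phi_fin t0).
- by move=> w _; exact: expeR_ge0.
rewrite (laplace_sum_poisson_point_process hphi phi_fin t0 l0).
have f0 s : Rpos s -> 0 <= (1 - expR (- (l * s)))%:E.
  by move=> Ps; rewrite lee_fin one_sub_expR_ge0.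
have mf := @measurable_one_sub_expR R l Rpos.
have [mI IE] := integral_mixed_levy_measure p mW mnu f0 mf.
rewrite integral_jump_measure; last 2 first.
- move=> x /ltW x0.
  by rewrite sube_ge0 ?fin_numE ?orbT// expeRN_le1// mule_ge0// lee_fin ltW.
- apply: emeasurable_funB; first exact: measurable_cst.
  apply: measurable_funTS; apply: (measurableT_comp (@measurable_expeR R)).
  apply: (measurableT_comp (@oppe_measurable R setT)).
  by apply: measurable_funeM.
(* At the jump [+oo] the integrand [1 - expeR -oo] equals 1, so the atom contributes exactly the
   killing rate [a y]. *)
rewrite (eq_integral (fun y =>
  \int[nu y]_(s in Rpos) (1 - expR (- (l * s)))%:E + (a y)%:E)); last first.
  by move=> y _; rewrite gt0_muley ?lte_fin//= sube0 mule1.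
rewrite ge0_integralD//; last first.
- by apply/measurable_EFinP; exact: measurable_funTS.
- by move=> y _; rewrite lee_fin.
- exact: measurable_funTS.
- by move=> y _; apply: integral_ge0.
have Ifin := integrable_fin_num mRpos (integrable_one_sub_expR Mfin l0).
rewrite -abarE -IE -(fineK Ifin) -EFinD -EFinM /=.
rewrite -expRD.
congr (expR _)%:E; rewrite /mixed_exponent /levy_khintchine /Rintegral.
by rewrite integral_Mt// fineM//=; ring.
Qed.

End law.
End distributed_order_laplace.

Lemma integral_lty_of_le {R : realType} d (Y : measurableType d)
    (p : probability Y R) (W : set Y) (f : Y -> \bar R) (M : R) :
  measurable W -> measurable_fun W f -> (forall y, 0 <= f y <= M%:E)%E ->
  (\int[p]_(y in W) f y < +oo)%E.
Proof.
move=> mW mf fM; apply: (@le_lt_trans _ _ (\int[p]_(y in W) (cst M%:E) y)%E).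
  apply: ge0_le_integral => //.
  - by move=> y _; have /andP[] := fM y.
  - by move=> y _; have /andP[] := fM y.
rewrite integral_cst//; apply: (@le_lt_trans _ _ `|M|%:E); last exact: ltry.
apply: (@le_trans _ _ (`|M|%:E * p W)%E).
  by rewrite lee_wpmul2r// lee_fin ler_norm.
by rewrite -[leRHS]mule1 lee_wpmul2l// ?probability_le1.
Qed.

Theorem proposition2p5 (R : realType) (E : ptopologicalType)
  (hE : polish_space R E)
  (W : set (borel E)) (hW : measurable W)
  (p : probability (borel E) R) (hp : p W = 1%E)
  (a b : borel E -> R) (nu : R.-sigmafker (borel E) ~> R)
  (ha0 : forall y, 0 <= a y) (hb0 : forall y, 0 <= b y)
  (hnu0 : forall y, nu y `]-oo, 0]%classic = 0%E)
  (hV : forall y, (truncated_mass (nu y) < +oo)%E)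
  (* A1 *)
  (ha : measurable_fun [set: borel E] a) (hb : measurable_fun [set: borel E] b)
  (A1 : (exists M : R, forall y, a y <= M /\ b y <= M) \/
        ((\int[p]_(y in W) (a y)%:E < +oo)%E /\
         (\int[p]_(y in W) (b y)%:E < +oo)%E))
  (* A2 *)
  (A2 : (exists M : R, forall y, (truncated_mass (nu y) <= M%:E)%E) \/
        (\int[p]_(y in W) truncated_mass (nu y) < +oo)%E)
  (* the subordinators with Laplace exponents f(., y) *)
  (dS : borel E -> measure_display)
  (Omega : forall y : borel E, measurableType (dS y))
  (P : forall y : borel E, probability (Omega y) R)
  (sigma : forall y : borel E, R -> Omega y -> \bar R)
  (hsigma : forall y : borel E,
     subordinator (P y) (sigma y) (levy_khintchine (a y) (b y) (nu y)))
  (* the Poisson point process defining the distributed order subordinator *)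
  (dQ : measure_display) (Theta : measurableType dQ) (Q : probability Theta R)
  (e : R -> Theta -> \bar R)
  (he : poisson_point_process Q e (mixed_characteristic_measure p W a nu))
  (t : R) (ht : 0 <= t)
  (hGGC : forall y : borel E, exists2 mu : {measure set R -> \bar R},
     finite_law (P y) (sigma y t) mu & GGC mu) :
  exists2 mu : {measure set R -> \bar R},
    finite_law Q (distributed_order_subordinator p W b e t) mu & GGC mu.
Proof.
pose nu_ y : {measure set R -> \bar R} := nu y.
have mnu U : measurable U -> measurable_fun setT (nu_ ^~ U).
  by move=> mU; exact: (measurable_kernel nu U mU).
have V0 y : (0 <= truncated_mass (nu_ y))%E.
  apply: integral_ge0 => s; rewrite /= in_itv/= andbT => s0.
  by rewrite lee_fin le_min ler01 ltW.
have mV : measurable_fun setT (fun y => truncated_mass (nu_ y)).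
  have mmin : measurable_fun (`]0, +oo[%classic : set R) (fun s : R => (Num.min s 1)%:E).
    by apply/measurable_EFinP; exact: measurable_minr.
  have [|//] := integral_mixed_levy_measure p hW mnu _ mmin.
  by move=> s; rewrite /= in_itv/= andbT => s0; rewrite lee_fin le_min ler01 ltW.
(* The bounded alternatives of A1 and A2 are reduced to the integrable ones, [p] being a
   probability. *)
have afin : (\int[p]_(y in W) (a y)%:E < +oo)%E.
  case: A1 => [[M aM]|[]//]; apply: (@integral_lty_of_le _ _ _ _ _ _ M) => //.
    by apply/measurable_EFinP; exact: measurable_funTS.
  by move=> y; rewrite !lee_fin ha0 (aM y).1.
have bfin : (\int[p]_(y in W) (b y)%:E < +oo)%E.
  case: A1 => [[M bM]|[]//]; apply: (@integral_lty_of_le _ _ _ _ _ _ M) => //.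
    by apply/measurable_EFinP; exact: measurable_funTS.
  by move=> y; rewrite !lee_fin hb0 (bM y).2.
have Vfin : (\int[p]_(y in W) truncated_mass (nu_ y) < +oo)%E.
  case: A2 => [[M VM]|//]; apply: (@integral_lty_of_le _ _ _ _ _ _ M) => //.
    exact: measurable_funTS.
  by move=> y; rewrite V0 VM.
pose S := distributed_order_subordinator p W b e t.
have S0 : forall w, (0 <= S w)%E := distributed_order_subordinator_ge0 hb0 bfin ht he.
have mS : measurable_fun setT S.
  exact: (measurable_distributed_order_subordinator hW b mnu ha0 ha afin Vfin ht he).
have [mu [muS _]] := finite_law_exists Q mS.
exists mu => //; split; first exact: finite_law_neg muS.
exists (mixed_exponent p hW a b mnu ht) => [|l l0]; last first.
  rewrite (finite_law_laplace muS S0 l0).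
  exact: (laplace_distributed_order_subordinator hW mnu ha0 hb0 ha afin bfin
    Vfin ht he l0).
split; first exact: bernstein_mixed_exponent.
apply: stieltjes_mixed_exponent => // y.
have [mu_y law_y [_ [g [_ g_stieltjes] g_laplace]]] := hGGC y.
have sub := hsigma y.
have sigma0 w : (0 <= sigma y t w)%E.
  by rewrite -(subordinator0 sub w); exact: (subordinator_nondecreasing sub).
(* The law at time [t] has Laplace transform [e^(-g)] by GGC and [e^(-t f(., y))] by the
   subordinator; injectivity of the exponential identifies the exponents. *)
have gE x : 0 < x -> g x = t * levy_khintchine (a y) (b y) (nu_ y) x.
  move=> x0; have := g_laplace x x0.
  rewrite (finite_law_laplace law_y sigma0 x0) (subordinator_laplace sub)//.
  by move=> -[/expR_inj/oppr_inj].
(* The exponents agree only on the positive half-line, which is open, so their derivatives agree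
   there and the Stieltjes property carries over. *)
apply: eq_stieltjes g_stieltjes => l l0.
rewrite (eq_derive1_pos gE l0) derive1E.
have dLK := is_derive_levy_khintchine (a y) (b y) (hV y) l0.
rewrite derive_val /GRing.scale/=.
by []. Qed.
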